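(* The following decision problem is NP-complete: given a fan-star $G$ and a set $S$ of unordered pairs $\{e,f\}$ of distinct edges of $G$ such that $e$ and $f$ are adjacent (share an endpoint) for every pair in $S$, decide whether $G$ has a spanning tree $T$ such that for every $\{e,f\}\in S$ at most one of $e,f$ belongs to $T$ (this is the problem FSTAC restricted to fan-stars).
   Context: Given a path $v_1-v_2-\cdots-v_n$, the fan $F_n$ is obtained by adding a new node $u$ and edges $(u,v_i)$ for $i=1,\ldots,n$. When $n=3k$, the fan-star $FS_n$ is obtained from $F_n$ by deleting the edges $(v_{3i},v_{3i+1})$ for $i=1,\ldots,k-1$. Two edges are adjacent if they share an endpoint. *)

(* Defs.v *)
(* MathComp *)
From mathcomp Require Import all_boot all_order all_algebra.

Set Implicit Arguments.
Unset Strict Implicit.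
Unset Printing Implicit Defensive.

(** * Deterministic multi-tape Turing machines *)

(* [None] is the blank, [Some (inl b)] the input/output symbol [b], and
   [Some (inr w)] a work symbol of the machine. *)
Definition tsym (W : finType) : Type := option (bool + W).
Definition blank {W : finType} : tsym W := None.
Definition bit {W : finType} (b : bool) : tsym W := Some (inl b).

Inductive move := MoveLeft | MoveStay | MoveRight.

(* A two-way infinite tape: [tleft] and [tright] list the cells on either side
   of the head, nearest first; all the cells not listed are blank. *)
Record tape (W : finType) := Tape {
  tleft : seq (tsym W);
  thead : tsym W;
  tright : seq (tsym W)
}.

Definition load (W : finType) (x : seq bool) : tape W :=
  let s := map bit x in Tape [::] (head blank s) (behead s).

(* The output is the maximal block of bits that starts at the head and extends
   to its right. *)
Fixpoint read_bits (W : finType) (s : seq (tsym W)) : seq bool :=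
  if s is Some (inl b) :: s' then b :: read_bits s' else [::].

Definition unload (W : finType) (t : tape W) : seq bool :=
  read_bits (thead t :: tright t).

Definition act (W : finType) (a : tsym W * move) (t : tape W) : tape W :=
  let: (s, m) := a in
  match m with
  | MoveLeft => Tape (behead (tleft t)) (head blank (tleft t)) (s :: tright t)
  | MoveStay => Tape (tleft t) s (tright t)
  | MoveRight => Tape (s :: tleft t) (head blank (tright t)) (behead (tright t))
  end.

(* The machine has the tapes 0, ..., [extra_tapes]. *)
Record machine := Machine {
  state : finType;
  work : finType;
  extra_tapes : nat;
  start : state;
  halting : pred state;
  accepting : pred state;
  delta : state -> {ffun 'I_extra_tapes.+1 -> tsym work} ->
          state * {ffun 'I_extra_tapes.+1 -> tsym work * move}
}.

Definition config (M : machine) : Type :=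
  (state M * {ffun 'I_(extra_tapes M).+1 -> tape (work M)})%type.

(* The i-th input is written on tape i; the other tapes are blank. *)
Definition init (M : machine) (inputs : seq (seq bool)) : config M :=
  (start M, [ffun i : 'I__ => load (work M) (nth [::] inputs i)]).

Definition step (M : machine) (c : config M) : config M :=
  let: (q, ts) := c in
  if halting q then c else
  let: (q', a) := delta q [ffun i => thead (ts i)] in
  (q', [ffun i => act (a i) (ts i)]).

Definition run (M : machine) (t : nat) (inputs : seq (seq bool)) : config M :=
  iter t (@step M) (init M inputs).

(** * Polynomial time and NP-completeness *)

Definition language : Type := seq bool -> Prop.

Definition polytime_fun (f : seq bool -> seq bool) : Prop :=
  exists (M : machine) (p : {poly nat}), forall x : seq bool,
    let c := run M p.[size x]%R [:: x] in
    halting c.1 /\ unload (c.2 ord0) = f x.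

Definition polytime_rel (V : seq bool -> seq bool -> bool) : Prop :=
  exists (M : machine) (p : {poly nat}), forall x y : seq bool,
    let c := run M p.[(size x + size y)%N]%R [:: x; y] in
    halting c.1 /\ accepting c.1 = V x y.

Definition NP (L : language) : Prop :=
  exists (V : seq bool -> seq bool -> bool) (p : {poly nat}),
    polytime_rel V /\
    forall x, L x <-> exists y, size y <= p.[size x]%R /\ V x y.

Definition polytime_reducible (L L' : language) : Prop :=
  exists f, polytime_fun f /\ forall x, L x <-> L' (f x).

Definition NP_hard (L : language) : Prop :=
  forall L', NP L' -> polytime_reducible L' L.

Definition NP_complete (L : language) : Prop := NP L /\ NP_hard L.

(** * Finite simple graphs, given by their set of edges *)

Section Graphs.
Variable V : finType.
Implicit Types (E T : {set {set V}}) (S : {set {set {set V}}}).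

Definition is_graph E : Prop := forall e, e \in E -> #|e| = 2.

Definition adj E : rel V := [rel x y | (x != y) && ([set x; y] \in E)].

Definition connected_graph E : Prop := forall x y, connect (adj E) x y.

Definition acyclic_graph E : Prop :=
  forall c : seq V, 2 < size c -> ~ ucycle (adj E) c.

Definition spanning_tree E T : Prop :=
  [/\ T \subset E, connected_graph T & acyclic_graph T].

Definition adjacent_edges (e f : {set V}) : Prop := exists x, x \in e :&: f.

Definition conflict_set E S : Prop :=
  forall P, P \in S -> exists e f : {set V},
    [/\ P = [set e; f], e \in E, f \in E, e != f & adjacent_edges e f].

Definition avoids_conflicts S T : Prop :=
  forall e f, [set e; f] \in S -> ~ (e \in T /\ f \in T).

Definition FSTAC E S : Prop :=
  exists T, spanning_tree E T /\ avoids_conflicts S T.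

End Graphs.

(** * Fans and fan-stars *)

(* On the vertices 0, ..., n: vertex 0 is the hub u, vertex i > 0 is v_i; all
   the arguments of [inord] are in range. *)
Definition fan (n : nat) : {set {set 'I_n.+1}} :=
  [set [set inord i; inord i.+1] | i : 'I_n & 0 < i]
  :|: [set [set ord0; i] | i : 'I_n.+1 & 0 < i].

Definition fan_star (k : nat) : {set {set 'I_(3 * k).+1}} :=
  fan (3 * k) :\:
  [set [set inord (3 * i); inord (3 * i).+1] | i : 'I_k & 0 < i].

Definition is_fan_star (V : finType) (E : {set {set V}}) : Prop :=
  exists (k : nat) (f : 'I_(3 * k).+1 -> V),
    [/\ 0 < k, bijective f & E = [set f @: e | e : {set _} in fan_star k]].

(** * Encoding of instances *)

(* Vertices are 0, ..., [order] - 1.  The lists stand for sets: order,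
   repetitions, and the orientation of the pairs are irrelevant. *)
Record instance := Instance {
  order : nat;
  edge_list : seq ('I_order * 'I_order);
  conflict_list : seq (('I_order * 'I_order) * ('I_order * 'I_order))
}.

Definition edge_of (n : nat) (p : 'I_n * 'I_n) : {set 'I_n} := [set p.1; p.2].

Definition edge_set (I : instance) : {set {set 'I_(order I)}} :=
  [set:: [seq edge_of p | p <- edge_list I]].

Definition conflicts (I : instance) : {set {set {set 'I_(order I)}}} :=
  [set:: [seq [set edge_of p.1; edge_of p.2] | p <- conflict_list I]].

(* Self-delimiting codes.  Unary numerals are harmless: they only name
   vertices, hence are bounded by the number of vertices. *)
Definition encode_nat (n : nat) : seq bool := rcons (nseq n true) false.

Definition encode_seq (A : Type) (enc : A -> seq bool) (s : seq A) : seq bool :=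
  rcons (flatten [seq true :: enc a | a <- s]) false.

Definition encode_pair (A B : Type) (encA : A -> seq bool)
    (encB : B -> seq bool) (p : A * B) : seq bool :=
  encA p.1 ++ encB p.2.

Definition encode_edge (n : nat) : 'I_n * 'I_n -> seq bool :=
  encode_pair (fun i : 'I_n => encode_nat i) (fun i : 'I_n => encode_nat i).

Definition encode_instance (I : instance) : seq bool :=
  encode_nat (order I) ++
  encode_seq (@encode_edge (order I)) (edge_list I) ++
  encode_seq (encode_pair (@encode_edge (order I)) (@encode_edge (order I)))
    (conflict_list I).

Definition FSTAC_on_fan_stars : language := fun w =>
  exists I : instance,
    [/\ w = encode_instance I,
        is_graph (edge_set I) /\ is_fan_star (edge_set I),
        conflict_set (edge_set I) (conflicts I)
      & FSTAC (edge_set I) (conflicts I)].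

(* Main.v *)
Require Import Defs.
From mathcomp Require Import all_boot all_order all_algebra.
From mathcomp Require Import zify.
Import Defs GRing.Theory.

(* Hardness.  Two hub edges are always adjacent, so conflicts may join any two of
   them.  When only hub edges conflict, a spanning tree amounts to a choice of at
   least one vertex in every triple without conflicting choices: a tree meets
   every triple since the hub must be reached, and one chosen vertex per triple
   together with all the path edges is a tree.  A chain of D triples chooses one of
   D values, hence the problem expresses binary constraints over any fixed
   finite domain.  These describe the computations of a nondeterministic
   machine: the tile at time t and position p records the state, the scanned
   symbols, the symbol of every tape at p and on which side of p its head is,
   and consistency involves neighbouring tiles only.

   Membership.  Conflict avoidance passes to subgraphs, so a connected subgraph
   may be replaced by a breadth-first tree in it; a certificate is an
   isomorphism with the standard fan-star and the parents and heights of a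
   rooted tree.

   Both arguments need functions computable in polynomial time: these are
   written in a language of expressions without assignment, where loops run
   over values and only concatenate their results, so that sizes and times are
   polynomially bounded by structural induction. *)

(** Choosing a vertex in every triple without conflicts is satisfiability of 3-clauses, conflicts
    playing the part of complementary literals. The chain of triples is the classical splitting of a
    long clause: the last vertex of one triple and the first of the next act as a fresh variable and
    its negation. Since the domain depends on the machine alone, no propositional formula is needed
    in between. The obstacle in the tableau is that a constraint joins two nodes only, while a step
    depends on all the heads, which may be far apart. So the cells of a row carry copies of the
    state and of the scanned symbols: neighbours compare their copies, and the cell under a head
    vouches for its symbol. The verifier never parses its input: it rebuilds an encoded instance
    from the certificate and compares the two strings. Numbers are unary throughout, so that a loop
    over a string of ones is a bounded quantifier and arithmetic reduces to counting. *)

Set Implicit Arguments.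
Unset Strict Implicit.
Unset Printing Implicit Defensive.

(** * Expressions *)

(* [Loop e e0 e1] runs through the value of [e] from its last symbol to the
   first, evaluates [e0] or [e1] according to the symbol, with the preceding
   symbols bound to variable 0, and concatenates the results. *)
Inductive exp :=
  | Skip
  | Emit of bool
  | Cat of exp & exp
  | Var of nat
  | Loop of exp & exp & exp
  | IfLe of exp & exp & exp & exp.

Fixpoint back (f : seq bool -> bool -> seq bool) (r : seq bool) : seq bool :=
  if r is b :: r' then f (rev r') b ++ back f r' else [::].

Fixpoint eval (env : seq (seq bool)) (e : exp) : seq bool :=
  match e with
  | Skip => [::]
  | Emit b => [:: b]
  | Cat e1 e2 => eval env e1 ++ eval env e2
  | Var v => nth [::] env v
  | Loop e e0 e1 =>
      back (fun s b => if b then eval (s :: env) e1 else eval (s :: env) e0)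
           (rev (eval env e))
  | IfLe e e' e1 e2 =>
      if size (eval env e) <= size (eval env e') then eval env e1
      else eval env e2
  end.

(** * Compilation to Turing machines *)

(** An instruction reads and writes a single tape, its first component; the last number it returns
    is the address of the next instruction. Tapes are indexed by all naturals here, and cut down to
    finitely many only when a machine is built. *)
Definition instr : Type := nat * (option bool -> option bool * move * nat).
Definition noop : instr := (0, fun r => (r, MoveStay, 0)).
Definition code := seq instr.

Definition rd (s : tsym void) : option bool :=
  if s is Some (inl b) then Some b else None.
Definition wr (s : option bool) : tsym void := omap inl s.

Definition conf : Type := nat * (nat -> tape void).

Definition exec (C : code) (c : conf) : conf :=
  let: (pc, ts) := c in
  if size C <= pc then c else
  let: (v, f) := nth noop C pc in
  let: a := f (rd (thead (ts v))) in
  (a.2, fun j => if j == v then act (wr a.1.1, a.1.2) (ts j) else ts j).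

Arguments exec : simpl never.

(* The head stands between [s1] and [s2], on the first symbol of [s2]. *)
Definition mid (s1 s2 : seq bool) (t : tape void) : Prop :=
  exists a b, t = Tape (rev (map bit s1) ++ nseq a blank)
                       (head blank (map bit s2))
                       (behead (map bit s2) ++ nseq b blank).

Definition rest (s : seq bool) (t : tape void) : Prop := mid s [::] t.

(* The head is on the blank that precedes [s]. *)
Definition before (s : seq bool) (t : tape void) : Prop :=
  exists a b, t = Tape (nseq a blank) blank (map bit s ++ nseq b blank).

(** * Single moves and the tape invariants *)

Lemma behead_nseq (T : Type) n (x : T) : behead (nseq n x) = nseq n.-1 x.
Proof. by case: n. Qed.

Lemma head_nseq (T : Type) n (x : T) : head x (nseq n x) = x.
Proof. by case: n. Qed.

Lemma mid_head s1 s2 t : mid s1 s2 t -> rd (thead t) = ohead s2.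
Proof. by case=> a [b ->]; case: s2. Qed.

Lemma before_head s t : before s t -> rd (thead t) = None.
Proof. by case=> a [b ->]. Qed.

(** Leaving the end of the string to the left lists a blank explicitly on the right; this is why the
    invariants tolerate listed blanks at both ends. *)
Lemma mid_left s1 c s2 t :
  mid (rcons s1 c) s2 t -> mid s1 (c :: s2) (act (wr (ohead s2), MoveLeft) t).
Proof.
case=> a [b ->]; rewrite map_rcons rev_rcons /=.
case: s2 => [|d s2] /=; first by exists a, b.+1.
by exists a, b.
Qed.

Lemma mid_left0 s t : mid [::] s t -> before s (act (wr (ohead s), MoveLeft) t).
Proof.
case=> a [b ->] /=; rewrite head_nseq behead_nseq.
case: s => [|c s] /=; first by exists a.-1, b.+1.
by exists a.-1, b.
Qed.

Lemma before_right s t : before s t -> mid [::] s (act (wr None, MoveRight) t).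
Proof.
case=> a [b ->] /=; case: s => [|c s] /=; last by exists a.+1, b.
by rewrite head_nseq behead_nseq; exists a.+1, b.-1.
Qed.

Lemma mid_right s1 c s2 t :
  mid s1 (c :: s2) t -> mid (rcons s1 c) s2 (act (wr (Some c), MoveRight) t).
Proof.
case=> a [b ->] /=; rewrite /mid map_rcons rev_rcons.
case: s2 => [|d s2] /=; last by exists a, b.
by rewrite head_nseq behead_nseq; exists a, b.-1.
Qed.

Lemma rest_push s c t : rest s t -> rest (rcons s c) (act (wr (Some c), MoveRight) t).
Proof.
case=> a [b ->] /=; rewrite /rest /mid map_rcons rev_rcons.
by rewrite head_nseq behead_nseq; exists a, b.-1.
Qed.

Lemma mid_erase s c t : mid s [:: c] t -> rest s (act (wr None, MoveStay) t).
Proof. by case=> a [b ->]; exists a, b. Qed.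

Lemma before_rest t : before [::] t -> rest [::] t.
Proof. by case=> a [b ->]; exists a, b. Qed.

Lemma rest_before t : rest [::] t -> before [::] t.
Proof. by case=> a [b ->]; exists a, b. Qed.

Lemma mid_stay s1 s2 t :
  mid s1 s2 t -> mid s1 s2 (act (wr (ohead s2), MoveStay) t).
Proof. by case=> a [b ->]; exists a, b; case: s2. Qed.

Lemma before_stay s t : before s t -> before s (act (wr None, MoveStay) t).
Proof. by case=> a [b ->]; exists a, b. Qed.

Lemma before_write s c t :
  before s t -> before (c :: s) (act (wr (Some c), MoveLeft) t).
Proof.
by case=> a [b ->]; exists a.-1, b; rewrite /= head_nseq behead_nseq.
Qed.

(** Every tape is a stack with its top at the right end: appending a symbol takes one step, and a
    string is consumed from its last symbol, which dictates the order of [Loop]. *)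
Definition repr (g : nat -> seq bool) (ts : nat -> tape void) : Prop :=
  forall j, rest (g j) (ts j).

(** * Code fragments at absolute addresses and their specifications *)

Definition code_at (C : code) (off : nat) (c : code) : Prop :=
  exists l r, C = l ++ c ++ r /\ off = size l.

Lemma code_at_cat C off c1 c2 :
  code_at C off (c1 ++ c2) -> code_at C off c1 /\ code_at C (off + size c1) c2.
Proof.
case=> l [r [-> ->]]; split; first by exists l, (c2 ++ r); rewrite !catA.
by exists (l ++ c1), r; rewrite size_cat !catA.
Qed.

Lemma code_at_cons C off i c : code_at C off (i :: c) -> code_at C off [:: i] /\ code_at C off.+1 c.
Proof. by rewrite -cat1s => /code_at_cat; rewrite addn1. Qed.

Lemma exec_at C pc v f ts : code_at C pc [:: (v, f)] ->
  let a := f (rd (thead (ts v))) in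
  exec C (pc, ts) =
  (a.2, fun j => if j == v then act (wr a.1.1, a.1.2) (ts j) else ts j).
Proof.
case=> l [r [-> ->]] /=; rewrite /exec !size_cat /= leqNgt.
by rewrite -[X in X < _]addn0 ltn_add2l /= nth_cat ltnn subnn.
Qed.

(** A Hoare triple with a time bound. The number of steps is only bounded because it depends on the
    data, and the tapes are described only up to listed blanks. *)
Definition spec C n pc g pc' g' : Prop := forall ts, repr g ts ->
  exists m ts', [/\ m <= n, iter m (exec C) (pc, ts) = (pc', ts') & repr g' ts'].

Lemma spec_refl C pc g : spec C 0 pc g pc g.
Proof. by move=> ts Hts; exists 0, ts. Qed.

Lemma spec_trans C n1 n2 p1 p2 p3 g1 g2 g3 :
  spec C n1 p1 g1 p2 g2 -> spec C n2 p2 g2 p3 g3 -> spec C (n1 + n2) p1 g1 p3 g3.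
Proof.
move=> H1 H2 ts /H1[m1 [ts1 [le1 E1 /H2[m2 [ts2 [le2 E2 R2]]]]]].
by exists (m2 + m1), ts2; rewrite iterD E1 E2 addnC leq_add.
Qed.

Lemma spec_weak C n n' p p' g g' g1 :
  spec C n p g p' g' -> n <= n' -> g' =1 g1 -> spec C n' p g p' g1.
Proof.
move=> H le_n Eg ts /H[m [ts' [lem E R']]].
exists m, ts'; split=> [||j]; rewrite -?Eg //; exact: leq_trans lem le_n.
Qed.

Definition upd (g : nat -> seq bool) v s := fun j => if j == v then s else g j.

Lemma spec_push C pc v b pc' g :
  code_at C pc [:: (v, fun=> (Some b, MoveRight, pc'))] ->
  spec C 1 pc g pc' (upd g v (rcons (g v) b)).
Proof.
move=> H ts R; exists 1; eexists; split=> //=; first by rewrite (exec_at _ H) /=.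
by move=> j /=; rewrite /upd; case: eqP => [->|_] //; exact: rest_push.
Qed.

Lemma spec_jump C pc v pc' g :
  code_at C pc [:: (v, fun r => (r, MoveStay, pc'))] -> spec C 1 pc g pc' g.
Proof.
move=> H ts R; exists 1; eexists; split=> [//||]; first by rewrite /= (exec_at _ H) /=.
move=> j /=; case: eqP => [->|_] //; rewrite (mid_head (R v)).
exact: mid_stay (R v).
Qed.

(** The lock keeps simplification from expanding [pop] into its two instructions inside larger
    pieces of code. *)
Fact pop_key : unit. Proof. exact: tt. Qed.

Definition pop : nat -> nat -> nat -> nat -> nat -> code :=
  locked_with pop_key (fun v pc pn p0 p1 =>
    [:: (v, fun r => (r, MoveLeft, pc.+1));
        (v, fun r => (None, MoveStay,
              if r is Some b then (if b then p1 else p0) else pn))]).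

Lemma popE v pc pn p0 p1 : pop v pc pn p0 p1 =
  [:: (v, fun r => (r, MoveLeft, pc.+1));
      (v, fun r => (None, MoveStay,
            if r is Some b then (if b then p1 else p0) else pn))].
Proof. by rewrite /pop unlock. Qed.

Lemma size_pop v pc pn p0 p1 : size (pop v pc pn p0 p1) = 2.
Proof. by rewrite popE. Qed.

(** On an empty stack the head steps onto another blank and stays there, which is again a correct
    position behind the empty string. *)
Lemma spec_pop0 C pc v pn p0 p1 g : code_at C pc (pop v pc pn p0 p1) ->
  g v = [::] -> spec C 2 pc g pn g.
Proof.
rewrite popE => /code_at_cons[H1 H2] gv ts R; exists 2; eexists; split=> [//||].
  rewrite /= (exec_at _ H1) /= (exec_at _ H2) /= eqxx.
  have := R v; rewrite gv => Rv; rewrite (mid_head Rv) /=.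
  by rewrite (before_head (mid_left0 Rv)).
move=> j /=; case: eqP => [->|_] //; have := R v; rewrite gv => Rv.
apply: before_rest; apply: before_stay.
exact: mid_left0 Rv.
Qed.

Lemma spec_pop1 C pc v pn p0 p1 g s b : code_at C pc (pop v pc pn p0 p1) ->
  g v = rcons s b -> spec C 2 pc g (if b then p1 else p0) (upd g v s).
Proof.
rewrite popE => /code_at_cons[H1 H2] gv ts R; exists 2; eexists; split=> [//||].
  rewrite /= (exec_at _ H1) /= (exec_at _ H2) /= eqxx.
  have := R v; rewrite gv => Rv; rewrite (mid_head Rv) /=.
  by rewrite (mid_head (mid_left Rv)).
move=> j /=; rewrite /upd; case: eqP => [->|_] //.
have := R v; rewrite gv => Rv.
by apply: mid_erase; apply: mid_left Rv.
Qed.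

Definition clear v pc : code := pop v pc pc.+2 pc pc.

Lemma spec_clear C pc v g : code_at C pc (clear v pc) ->
  spec C (2 * (size (g v)).+1) pc g pc.+2 (upd g v [::]).
Proof.
move=> H; move gv: (g v) => s; elim/last_ind: s g gv => [|s b IHs] g gv.
  apply: (spec_weak (spec_pop0 H gv)) => // j.
  by rewrite /upd; case: eqP => // ->.
have := spec_pop1 H gv; rewrite if_same => H1.
have E : upd g v s v = s by rewrite /upd eqxx.
apply: (spec_weak (spec_trans H1 (IHs _ E))) => //.
  by rewrite size_rcons; lia.
by move=> j; rewrite /upd; case: eqP.
Qed.

(** Instructions 0 and 1 rewind tape [t] to the blank before its string; 2 walks forward and
    branches on the symbol, which 3 or 4 appends to tape [o]. The walk ends behind the string of
    [t], so that tape is restored. *)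
Definition copy_code t o pc : code :=
  [:: (t, fun r => (r, MoveLeft, pc.+1));
      (t, fun r => if r is None then (r, MoveRight, pc.+2)
                   else (r, MoveLeft, pc.+1));
      (t, fun r => if r is Some b then (r, MoveRight, if b then pc.+4 else pc.+3)
                   else (r, MoveStay, pc.+4.+1));
      (o, fun=> (Some false, MoveRight, pc.+2));
      (o, fun=> (Some true, MoveRight, pc.+2))].

(** The part still to be crossed, [s1], is listed from the head outwards, which makes the induction
    structural. *)
Lemma copy_rewind C pc t g s1 s2 ts :
  code_at C pc.+1 [:: (t, fun r => if r is None then (r, MoveRight, pc.+2)
                   else (r, MoveLeft, pc.+1))] ->
  (forall j, j != t -> rest (g j) (ts j)) ->
  (if s1 is c :: s1' then mid (rev s1') (c :: s2) (ts t) else before s2 (ts t)) ->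
  exists ts', [/\ iter (size s1).+1 (exec C) (pc.+1, ts) = (pc.+2, ts'),
     mid [::] (rev s1 ++ s2) (ts' t) & forall j, j != t -> rest (g j) (ts' j)].
Proof.
move=> H; elim: s1 s2 ts => [|c s1 IHs] s2 ts R Rt.
  eexists; split; first by rewrite /= (exec_at _ H) /= (before_head Rt).
    by rewrite /= eqxx; exact: before_right.
  by move=> j jt; rewrite /= (negPf jt); exact: R.
rewrite iterSr (exec_at _ H) /= (mid_head Rt) rev_cons -cats1 -catA /=.
apply: IHs => [j jt|]; first by rewrite /= (negPf jt); exact: R.
case: s1 Rt => [|d s1 Rt] /=; rewrite !eqxx.
  by move=> Rt; exact: mid_left0 Rt.
by apply: (@mid_left (rev s1) d (c :: s2)); rewrite -rev_cons.
Qed.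

Lemma copy_forward C pc t o g s1 s2 ts : o != t ->
  code_at C pc (copy_code t o pc) ->
  (forall j, j != t -> rest (g j) (ts j)) -> mid s1 s2 (ts t) ->
  exists ts', [/\ iter (2 * size s2).+1 (exec C) (pc.+2, ts) = (pc.+4.+1, ts'),
     mid (s1 ++ s2) [::] (ts' t)
     & forall j, j != t -> rest (upd g o (g o ++ s2) j) (ts' j)].
Proof.
move=> ot /code_at_cons[_ /code_at_cons[_ /code_at_cons[H2 /code_at_cons[H3 /code_at_cons[H4 _]]]]].
elim: s2 s1 g ts => [|c s2 IHs] s1 g ts R Rt.
  eexists; split; first by rewrite /= (exec_at _ H2) /= (mid_head Rt).
    by rewrite /= eqxx cats0; exact: mid_stay Rt.
  move=> j jt /=; rewrite (negPf jt) /upd; case: eqP => [->|_]; last exact: R.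
  by rewrite cats0; exact: R.
pose tsA := fun j => if j == t then act (wr (Some c), MoveRight) (ts j) else ts j.
pose ts1 := fun j => if j == o then act (wr (Some c), MoveRight) (tsA j) else tsA j.
have [||ts' [E Rt' R']] := IHs (rcons s1 c) (upd g o (rcons (g o) c)) ts1.
- move=> j jt; rewrite /ts1 /upd /tsA (negPf jt); case: eqP => [->|_].
    by apply: rest_push; exact: R.
  exact: R.
- by rewrite /ts1 /tsA eq_sym (negPf ot) eqxx; exact: mid_right.
exists ts'; split.
- rewrite mulnS add2n 2!iterSr (exec_at _ H2) (mid_head Rt) [ohead _]/=.
  rewrite -E; congr iter.
  rewrite /ts1 /tsA; case: (c); first by rewrite /= (exec_at _ H4).
  by rewrite /= (exec_at _ H3).
- by rewrite -cat_rcons.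
- by move=> j jt; have := R' j jt; rewrite /upd eqxx cat_rcons; case: eqP.
Qed.

Lemma spec_copy C pc t o g : o != t -> code_at C pc (copy_code t o pc) ->
  spec C (3 * size (g t) + 4) pc g pc.+4.+1 (upd g o (g o ++ g t)).
Proof.
move=> ot H ts R.
have [H0 /code_at_cons[H1 _]] := code_at_cons H.
pose ts1 := fun j => if j == t then act (wr None, MoveLeft) (ts j) else ts j.
have E1 : exec C (pc, ts) = (pc.+1, ts1).
  by rewrite (exec_at _ H0) (mid_head (R t)).
have [||ts2 [E2 Rt2 R2]] := @copy_rewind C pc t g (rev (g t)) [::] ts1 H1.
- by move=> j /negPf jt; rewrite /ts1 jt.
- rewrite /ts1 eqxx; have Rt := R t; case: (lastP (g t)) Rt => [|s c] Rt.
    exact: mid_left0 Rt.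
  by rewrite rev_rcons revK; exact: mid_left Rt.
rewrite revK cats0 in Rt2.
have [ts3 [E3 Rt3 R3]] := copy_forward ot H R2 Rt2.
exists ((2 * size (g t)).+1 + ((size (rev (g t))).+1 + 1)), ts3; split.
- by rewrite size_rev; lia.
- by rewrite !iterD [iter 1 _ _]/= E1 E2 E3.
move=> j; have [->|jt] := eqVneq j t; last exact: R3.
by rewrite /upd eq_sym (negPf ot).
Qed.

(** Jump targets are absolute, so lengths must be known before the code is generated. *)
Fixpoint code_length (e : exp) : nat :=
  match e with
  | Skip => 0
  | Emit _ => 1
  | Cat e1 e2 => code_length e1 + code_length e2
  | Var _ => 5
  | Loop e e0 e1 => code_length e + (2 + ((code_length e0 + 1) + (code_length e1 + 1)))
  | IfLe e e' e1 e2 =>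
      code_length e + (code_length e' + (4 + (2 + (code_length e1 + (1 + (2 + code_length e2))))))
  end.

(** The list [tp] gives the tapes of the variables, [o] is the output tape, the tapes from [fr] on
    are free, and [pc] is the address of the code. In a loop, popping the last symbol leaves on tape
    [fr] exactly the preceding symbols, so this tape itself serves as variable 0 of the body. *)
Fixpoint comp (tp : seq nat) (o fr pc : nat) (e : exp) : code :=
  match e with
  | Skip => [::]
  | Emit b => [:: (o, fun=> (Some b, MoveRight, pc.+1))]
  | Cat e1 e2 => comp tp o fr pc e1 ++ comp tp o fr (pc + code_length e1) e2
  | Var v => copy_code (nth fr tp v) o pc
  | Loop e e0 e1 =>
      let l := pc + code_length e in
      let l0 := l + 2 in
      let l1 := l0 + (code_length e0 + 1) in
      let l2 := l1 + (code_length e1 + 1) in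
      comp tp fr fr.+1 pc e ++ pop fr l l2 l0 l1 ++
      (comp (fr :: tp) o fr.+1 l0 e0 ++ [:: (fr, fun r => (r, MoveStay, l))]) ++
      (comp (fr :: tp) o fr.+1 l1 e1 ++ [:: (fr, fun r => (r, MoveStay, l))])
  | IfLe e e' e1 e2 =>
      let l' := pc + code_length e in
      let l := l' + code_length e' in
      let ly := l + 4 in
      let l1 := ly + 2 in
      let lj := l1 + code_length e1 in
      let ln := lj + 1 in
      let l2 := ln + 2 in
      comp tp fr fr.+1 pc e ++ comp tp fr.+1 fr.+2 l' e' ++
      (pop fr l ly l.+2 l.+2 ++ pop fr.+1 l.+2 ln l l) ++
      clear fr.+1 ly ++ comp tp o fr.+2 l1 e1 ++
      [:: (fr, fun r => (r, MoveStay, l2 + code_length e2))] ++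
      clear fr ln ++ comp tp o fr.+2 l2 e2
  end.

Lemma size_comp tp o fr pc e : size (comp tp o fr pc e) = code_length e.
Proof.
elim: e tp o fr pc => //= [e1 IH1 e2 IH2|e IH e0 IH0 e1 IH1|e IH e' IH' e1 IH1 e2 IH2] tp o fr pc.
- by rewrite size_cat IH1 IH2.
- by rewrite !(size_cat, size_pop, IH, IH0, IH1).
by rewrite !(size_cat, size_pop, IH, IH', IH1, IH2) /= !(size_cat, size_pop, IH1, IH2).
Qed.

(* [m] bounds the sizes of the variables. *)
Fixpoint size_bound (e : exp) (m : nat) : nat :=
  match e with
  | Skip => 0
  | Emit _ => 1
  | Cat e1 e2 => size_bound e1 m + size_bound e2 m
  | Var _ => m
  | Loop e e0 e1 => size_bound e m * (size_bound e0 (m + size_bound e m) + size_bound e1 (m + size_bound e m))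
  | IfLe e e' e1 e2 => size_bound e1 m + size_bound e2 m
  end.

(** In a loop, 3 counts a pop and the jump back, and the final 2 is the pop that finds the tape
    empty. In a comparison, every round costs two pops, hence 4; then come the clearing of the
    remainder and a jump. *)
Fixpoint time_bound (e : exp) (m : nat) : nat :=
  match e with
  | Skip => 0
  | Emit _ => 1
  | Cat e1 e2 => time_bound e1 m + time_bound e2 m
  | Var _ => 3 * m + 4
  | Loop e e0 e1 => time_bound e m +
      (size_bound e m * (time_bound e0 (m + size_bound e m) + time_bound e1 (m + size_bound e m) + 3) + 2)
  | IfLe e e' e1 e2 => time_bound e m + (time_bound e' m +
      (4 * (size_bound e m + 1) + (2 * (size_bound e m + size_bound e' m + 1)) + (time_bound e1 m + time_bound e2 m + 1)))
  end.

Definition bounded (env : seq (seq bool)) m := all (fun s => size s <= m) env.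

Lemma bounded_le env m m' : m <= m' -> bounded env m -> bounded env m'.
Proof. by move=> le_m; apply: sub_all => s /leq_trans; apply. Qed.

Lemma back_rcons f s b : back f (rev (rcons s b)) = f s b ++ back f (rev s).
Proof. by rewrite rev_rcons /= revK. Qed.

Lemma size_back f s B :
  (forall p b, size p < size s -> size (f p b) <= B) ->
  size (back f (rev s)) <= size s * B.
Proof.
elim/last_ind: s => //= s b IHs H.
rewrite back_rcons size_cat size_rcons mulSn leq_add ?H ?size_rcons //.
by apply: IHs => p c lt_p; apply: H; rewrite size_rcons ltnS ltnW.
Qed.

Lemma size_eval env e m : bounded env m -> size (eval env e) <= size_bound e m.
Proof.
elim: e env m => //= [e1 IH1 e2 IH2|v|e IH e0 IH0 e1 IH1|e _ e' _ e1 IH1 e2 IH2] env m H.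
- by rewrite size_cat leq_add ?IH1 ?IH2.
- have [lt_v|le_v] := ltnP v (size env); last by rewrite nth_default.
  by move/all_nthP: H; apply.
- have le_s := IH _ _ H.
  apply: leq_trans (leq_mul le_s (leqnn _)); apply: size_back => p b lt_p.
  have Hp : bounded (p :: env) (m + size_bound e m).
    by rewrite /= (bounded_le (leq_addr _ _) H); move: lt_p le_s; lia.
  case: b; first exact: leq_trans (IH1 _ _ Hp) (leq_addl _ _).
  exact: leq_trans (IH0 _ _ Hp) (leq_addr _ _).
case: ifP => _; first exact: leq_trans (IH1 _ _ H) (leq_addr _ _).
exact: leq_trans (IH2 _ _ H) (leq_addl _ _).
Qed.

Arguments clear : simpl never.

(** The conclusion changes tape [o] alone, so it also says that temporaries are empty again; this
    lets consecutive fragments share the same free tapes. The output must not be a variable, since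
    variables are still read while it grows. *)
Lemma spec_comp C e tp o fr pc g m :
  code_at C pc (comp tp o fr pc e) -> all (fun t => t < fr) tp -> o < fr ->
  o \notin tp -> (forall j, fr <= j -> g j = [::]) -> bounded (map g tp) m ->
  spec C (time_bound e m) pc g (pc + code_length e) (upd g o (g o ++ eval (map g tp) e)).
Proof.
elim: e tp o fr pc g m => /= [|b|e1 IH1 e2 IH2|v|e IH e0 IH0 e1 IH1|e IH e' IH' e1 IH1 e2 IH2]
  tp o fr pc g m HC Htp ofr otp gfr bm.
- rewrite addn0; apply: (spec_weak (@spec_refl C pc g)) => // j.
  by rewrite /upd; case: eqP => // ->; rewrite cats0.
- by rewrite addn1 cats1; apply: spec_push.
- have [H1 H2] := code_at_cat HC; rewrite size_comp in H2.
  have E : map (upd g o (g o ++ eval (map g tp) e1)) tp = map g tp.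
    by apply/eq_in_map => t t_tp; rewrite /upd; case: eqP => // E; rewrite -E t_tp in otp.
  have S2 := IH2 _ _ _ _ (upd g o (g o ++ eval (map g tp) e1)) m H2 Htp ofr otp.
  have gj j : fr <= j -> upd g o (g o ++ eval (map g tp) e1) j = [::].
    by move=> frj; rewrite /upd; case: eqP => [Ej|_]; [lia | exact: gfr].
  rewrite E in S2; rewrite addnA.
  apply: (spec_weak (spec_trans (IH1 _ _ _ _ _ _ H1 Htp ofr otp gfr bm) (S2 gj bm))) => // j.
  by rewrite /upd eqxx catA; case: eqP.
- have Et : g (nth fr tp v) = nth [::] (map g tp) v.
    have [lt_v|le_v] := ltnP v (size tp); first by rewrite (nth_map fr).
    by rewrite !nth_default ?size_map // gfr.
  have -> : pc + 5 = pc.+4.+1 by lia.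
  rewrite -Et; apply: (spec_weak (spec_copy _ HC)) => //; last first.
    rewrite Et; have [lt_v|le_v] := ltnP v (size (map g tp)).
      by have := elimT (all_nthP [::]) bm v lt_v; lia.
    by rewrite nth_default //=; lia.
  have [lt_v|le_v] := ltnP v (size tp).
    by apply/eqP => E; rewrite E mem_nth in otp.
  by rewrite nth_default //; lia.
- have [H1 /code_at_cat[H2 /code_at_cat[]]] := code_at_cat HC; rewrite size_comp in H2 *; rewrite size_pop.
  rewrite size_cat size_comp /= => /code_at_cat[H3 H3'] /code_at_cat[H4 H4'].
  rewrite size_comp in H3'; rewrite size_comp in H4'.
  set s := eval (map g tp) e in IH *.
  set l := pc + code_length e in H2 H3 H3' H4 H4' *; set l0 := l + 2 in H2 H3 H3' H4 H4' *.
  set l1 := l0 + _ in H2 H3 H3' H4 H4' *; set l2 := l1 + _ in H2 H3 H3' H4 H4' *.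
  have le_s : size s <= size_bound e m by exact: size_eval.
  set k := size_bound e m in le_s *; set c := time_bound e0 _ + _ + _.
  set f := fun (s : seq bool) (b : bool) => _.
  (* The loop started with the unread prefix [s'] on tape [fr], by induction from the right end
     because the tape is popped. *)
  have L : forall s' h, size s' <= k -> h fr = s' -> (forall j, fr < j -> h j = [::]) ->
     map h tp = map g tp ->
     spec C (size s' * c + 2) l h l2 (upd (upd h fr [::]) o (h o ++ back f (rev s'))).
    elim/last_ind => [|s' b IHs] h le_s' hfr hj Eh.
      apply: (spec_weak (spec_pop0 H2 hfr)) => // j; rewrite /upd /= cats0.
      by case: eqP => [->|_] //; case: eqP => // ->.
    rewrite size_rcons in le_s'; have S0 := spec_pop1 H2 hfr.
    set h1 := upd h fr s' in S0.
    have Eh1 : map h1 tp = map g tp.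
      rewrite -Eh; apply/eq_in_map => t t_tp; rewrite /h1 /upd; case: eqP => // E.
      by move/allP: Htp => /(_ t t_tp); rewrite E ltnn.
    have h1fr : h1 fr = s' by rewrite /h1 /upd eqxx.
    have h1o : h1 o = h o by rewrite /h1 /upd; case: eqP => // E; lia.
    have h1j j : fr < j -> h1 j = [::].
      by move=> lt_j; rewrite /h1 /upd; case: eqP => [E|_]; [lia|exact: hj].
    have bm1 : bounded (map h1 (fr :: tp)) (m + k).
      by rewrite /= Eh1 h1fr (bounded_le (leq_addr _ _) bm) andbT; lia.
    have Htp1 : all (fun t => t < fr.+1) (fr :: tp).
      by rewrite /= ltnS leqnn; apply: sub_all Htp => t; lia.
    have otp1 : o \notin fr :: tp by rewrite inE negb_or otp andbT; apply/eqP; lia.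
    have S1 : spec C (time_bound e0 (m + k) + time_bound e1 (m + k) + 1) (if b then l1 else l0) h1 l
        (upd h1 o (h o ++ f s' b)).
      rewrite -h1o /f; case: (b).
        apply: (spec_weak (spec_trans (IH1 _ _ _ _ _ _ H4 Htp1 (ltnW ofr) otp1 h1j bm1) (spec_jump H4'))) => //.
          by lia.
        by rewrite /= Eh1 h1fr.
      apply: (spec_weak (spec_trans (IH0 _ _ _ _ _ _ H3 Htp1 (ltnW ofr) otp1 h1j bm1) (spec_jump H3'))) => //.
        by lia.
      by rewrite /= Eh1 h1fr.
    set h2 := upd h1 o _ in S1.
    have h2fr : h2 fr = s' by rewrite /h2 /upd; case: eqP => [E|_]; [lia|exact: h1fr].
    have h2j j : fr < j -> h2 j = [::].
      by move=> lt_j; rewrite /h2 /upd; case: eqP => [E|_]; [lia|exact: h1j].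
    have Eh2 : map h2 tp = map g tp.
      rewrite -Eh1; apply/eq_in_map => t t_tp; rewrite /h2 /upd; case: eqP => // E.
      by rewrite -E t_tp in otp.
    apply: (spec_weak (spec_trans S0 (spec_trans S1 (IHs _ (ltnW le_s') h2fr h2j Eh2)))) => //.
      by rewrite size_rcons /c; lia.
    move=> j; rewrite back_rcons /h2 /h1 /upd eqxx; case: eqP => [_|_].
      by rewrite catA.
    by case: eqP.
  have Htp1 : all (fun t => t < fr.+1) tp by apply: sub_all Htp => t; lia.
  have frtp : fr \notin tp by apply/negP => /(allP Htp); rewrite ltnn.
  have S1 := IH _ _ _ _ _ _ H1 Htp1 (ltnSn fr) frtp (fun j le_j => gfr j (ltnW le_j)) bm.
  rewrite (gfr fr) //= -/s in S1.
  have Eg : map (upd g fr s) tp = map g tp.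
    by apply/eq_in_map => t t_tp; rewrite /upd; case: eqP => // E; rewrite -E t_tp in frtp.
  have gj j : fr < j -> upd g fr s j = [::].
    by move=> lt_j; rewrite /upd; case: eqP => [E|_]; [lia | apply: gfr; exact: ltnW].
  have := L s (upd g fr s) le_s; rewrite {1}/upd eqxx => /(_ erefl gj Eg) S2.
  rewrite -/l in S1; have -> : pc + (code_length e + (2 + (code_length e0 + 1 + (code_length e1 + 1)))) = l2.
    by rewrite /l2 /l1 /l0 /l; lia.
  apply: (spec_weak (spec_trans S1 S2)) => //.
    by rewrite leq_add2l leq_add2r leq_mul2r le_s orbT.
  move=> j; rewrite /upd; case: eqP => [Ej|_].
    by case: eqP => // E; lia.
  by case: eqP => // ->; rewrite gfr.
have Htp1 : all (fun t => t < fr.+1) tp by apply: sub_all Htp => t; lia.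
have Htp2 : all (fun t => t < fr.+2) tp by apply: sub_all Htp => t; lia.
have frtp : fr \notin tp by apply/negP => /(allP Htp); rewrite ltnn.
have frtp1 : fr.+1 \notin tp by apply/negP => /(allP Htp); lia.
have map_set h v s : v \notin tp -> map (upd h v s) tp = map h tp.
  move=> vtp; apply/eq_in_map => t t_tp; rewrite /upd; case: eqP => // E.
  by rewrite -E t_tp in vtp.
have setj h v s j : v < j -> upd h v s j = h j.
  by move=> lt_j; rewrite /upd; case: eqP => // E; lia.
have [H1 /code_at_cat[H2]] := code_at_cat HC; rewrite !size_comp in H2 *.
rewrite -catA => /code_at_cat[Ha] /code_at_cat[Hb] /code_at_cat[Hy] /code_at_cat[H3] /code_at_cons[Hj] /code_at_cat[Hn H4].
have code_at_eq p p' c : code_at C p c -> p = p' -> code_at C p' c by move=> ? <-.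
rewrite /clear !size_comp !size_pop in Hb Hy H3 Hj Hn H4.
set l' := pc + code_length e in H2 Ha Hb Hy H3 Hj Hn H4 *.
set l := l' + code_length e' in H2 Ha Hb Hy H3 Hj Hn H4 *.
set ly := l + 4 in H2 Ha Hb Hy H3 Hj Hn H4 *.
set l1 := ly + 2 in H2 Ha Hb Hy H3 Hj Hn H4 *.
set lj := l1 + code_length e1 in H2 Ha Hb Hy H3 Hj Hn H4 *.
set ln := lj + 1 in H2 Ha Hb Hy H3 Hj Hn H4 *.
set l2 := ln + 2 in H2 Ha Hb Hy H3 Hj Hn H4 *.
have {}Hb : code_at C l.+2 (pop fr.+1 l.+2 ln l l) by apply: code_at_eq Hb _; lia.
have {}Hy : code_at C ly (clear fr.+1 ly) by apply: code_at_eq Hy _; lia.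
have {}H3 : code_at C l1 (comp tp o fr.+2 l1 e1) by apply: code_at_eq H3 _; lia.
have {}Hj : code_at C lj [:: (fr, fun r => (r, MoveStay, l2 + code_length e2))].
  by apply: code_at_eq Hj _; lia.
have {}Hn : code_at C ln (clear fr ln) by apply: code_at_eq Hn _; lia.
have {}H4 : code_at C l2 (comp tp o fr.+2 l2 e2) by apply: code_at_eq H4 _; lia.
set s := eval _ e; set s' := eval _ e'.
have S1 := IH _ _ _ _ _ _ H1 Htp1 (ltnSn fr) frtp (fun j le_j => gfr j (ltnW le_j)) bm.
rewrite (gfr fr) //= -/s in S1.
have g1j j : fr < j -> upd g fr s j = [::].
  by move=> lt_j; rewrite setj // gfr // ltnW.
have := IH' _ _ _ _ (upd g fr s) m H2 Htp2 (ltnSn fr.+1) frtp1.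
rewrite map_set // => /(_ _ bm) S2.
have {}S2 := S2 (fun j le_j => g1j j (ltnW le_j)).
rewrite g1j // cat0s -/s' -/l in S2; set g2 := upd _ fr.+1 s' in S2.
(* Both tapes are popped alternately until one is empty. Tape [fr] is tested first, so ties go to
   [ly]; at either exit only one tape can have a remainder, and that branch clears it. *)
have L u u' h : h fr = u -> h fr.+1 = u' -> exists h',
   [/\ spec C (4 * (size u + 1)) l h (if size u <= size u' then ly else ln) h',
      forall j, j != fr -> j != fr.+1 -> h' j = h j
    & if size u <= size u' then h' fr = [::] /\ size (h' fr.+1) <= size u'
      else h' fr.+1 = [::] /\ size (h' fr) <= size u].
  elim/last_ind: u u' h => [|u b IHu] u' h hfr hfr1.
    exists h; rewrite hfr hfr1; split=> //.
    by apply: (spec_weak (spec_pop0 Ha hfr)).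
  have := spec_pop1 Ha hfr; rewrite if_same => Sa.
  have hb : upd h fr u fr.+1 = u' by rewrite setj.
  case/lastP: u' hfr1 hb => [|u' b'] hfr1 hb.
    exists (upd h fr u); rewrite size_rcons /=; split.
    - apply: (spec_weak (spec_trans Sa (spec_pop0 Hb hb))) => //; lia.
    - by move=> j /negPf jfr _; rewrite /upd jfr.
    - by rewrite hb /upd eqxx.
  have := spec_pop1 Hb hb; rewrite if_same => Sb.
  set h1 := upd _ _ u' in Sb.
  have [||h' [Sh hj hs]] := IHu u' h1; rewrite /h1 /upd ?eqxx //.
    by case: eqP => // E; lia.
  exists h'; rewrite !size_rcons ltnS; split.
  - apply: (spec_weak (spec_trans Sa (spec_trans Sb Sh))) => //; lia.
  - by move=> j /[dup] /negPf jfr ? /[dup] /negPf jfr1 ?; rewrite hj // /h1 /upd jfr jfr1.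
  by case: ifP hs => _ [-> le_s]; split=> //; exact: leqW.
have g2fr : g2 fr = s by rewrite /g2 /upd; case: eqP => [E|_]; [lia | rewrite eqxx].
have g2fr1 : g2 fr.+1 = s' by rewrite /g2 /upd eqxx.
have [h' [S3 hj hs]] := L s s' g2 g2fr g2fr1.
have hg j : j != fr -> j != fr.+1 -> h' j = g j.
  by move=> jfr jfr1; rewrite hj // /g2 /upd (negPf jfr) (negPf jfr1).
have -> : pc + (code_length e + (code_length e' + (4 + (2 + (code_length e1 + (1 + (2 + code_length e2))))))) = l2 + code_length e2.
  by rewrite /l2 /ln /lj /l1 /ly /l /l'; lia.
have frE h : (forall j, h j = g j) -> [/\ map h tp = map g tp, h o = g o & forall j, fr.+2 <= j -> h j = [::]].
  by move=> Eh; split=> // [|j lt_j]; [exact/eq_map | rewrite Eh gfr //; lia].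
have le_s : size s <= size_bound e m by exact: size_eval.
have le_s' : size s' <= size_bound e' m by exact: size_eval.
case: ifP hs S3 => _ [h0 h1] S3.
  have S4 := spec_clear Hy (g := h').
  set g4 := upd h' _ _ in S4.
  have E4 j : g4 j = g j.
    rewrite /g4 /upd; case: eqP => [->|/eqP jfr1]; first by rewrite gfr.
    by have [->|jfr] := eqVneq j fr; [rewrite h0 gfr | exact: hg].
  have [Em Eo E0] := frE _ E4.
  have := IH1 _ _ _ _ g4 m H3 Htp2 (leqW (leqW ofr)) otp E0.
  rewrite Em Eo => /(_ bm) S5; rewrite (_ : ly.+2 = l1) in S4; last by rewrite /l1 addn2.
  apply: (spec_weak (spec_trans S1 (spec_trans S2 (spec_trans S3 (spec_trans S4 (spec_trans S5 (spec_jump Hj))))))).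
    by lia.
  by move=> j; rewrite /upd; case: eqP => // _; exact: E4.
have S4 := spec_clear Hn (g := h').
set g4 := upd h' _ _ in S4.
have E4 j : g4 j = g j.
  rewrite /g4 /upd; case: eqP => [->|/eqP jfr]; first by rewrite gfr.
  by have [->|jfr1] := eqVneq j fr.+1; [rewrite h0 gfr | exact: hg].
have [Em Eo E0] := frE _ E4.
have := IH2 _ _ _ _ g4 m H4 Htp2 (leqW (leqW ofr)) otp E0.
rewrite Em Eo => /(_ bm) S5; rewrite (_ : ln.+2 = l2) in S4; last by rewrite /l2 addn2.
apply: (spec_weak (spec_trans S1 (spec_trans S2 (spec_trans S3 (spec_trans S4 S5))))).
  by lia.
by move=> j; rewrite /upd; case: eqP => // _; exact: E4.
Qed.

(** * Polynomial time *)

Definition poly_bounded (f : nat -> nat) : Prop :=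
  exists p : {poly nat}, forall n, f n <= p.[n]%R.

Lemma horner_nat_mono (p : {poly nat}) m n : m <= n -> p.[m]%R <= p.[n]%R.
Proof.
move=> le_mn; rewrite !horner_coef; elim/big_ind2: _ => // [a b c d|i _].
  by move=> ? ?; exact: leq_add.
apply: leq_mul => //; elim: (nat_of_ord i) => // k IHk.
by rewrite !exprS; exact: leq_mul.
Qed.

Lemma poly_bounded_const c : poly_bounded (fun=> c).
Proof. by exists (c%:P)%R => n; rewrite hornerC. Qed.

Lemma poly_bounded_id : poly_bounded id.
Proof. by exists ('X)%R => n; rewrite hornerX. Qed.

Lemma poly_bounded_add f g : poly_bounded f -> poly_bounded g -> poly_bounded (fun n => f n + g n).
Proof.
by move=> [p Hp] [q Hq]; exists (p + q)%R => n; rewrite hornerD leq_add ?Hp ?Hq.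
Qed.

Lemma poly_bounded_mul f g : poly_bounded f -> poly_bounded g -> poly_bounded (fun n => f n * g n).
Proof.
by move=> [p Hp] [q Hq]; exists (p * q)%R => n; rewrite hornerM leq_mul ?Hp ?Hq.
Qed.

Lemma poly_bounded_comp f g : poly_bounded f -> poly_bounded g -> poly_bounded (fun n => f (g n)).
Proof.
move=> [p Hp] [q Hq]; exists (p \Po q)%R => n; rewrite horner_comp.
exact: leq_trans (Hp _) (horner_nat_mono _ (Hq n)).
Qed.

Lemma poly_bounded_size_bound e : poly_bounded (size_bound e).
Proof.
elim: e => /= [|b|e1 H1 e2 H2|v|e H e0 H0 e1 H1|e _ e' _ e1 H1 e2 H2].
- exact: poly_bounded_const.
- exact: poly_bounded_const.
- exact: poly_bounded_add.
- exact: poly_bounded_id.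
- have Hm := poly_bounded_add poly_bounded_id H; apply: poly_bounded_mul => //.
  by apply: poly_bounded_add; [apply: (poly_bounded_comp H0 Hm) | apply: (poly_bounded_comp H1 Hm)].
exact: poly_bounded_add.
Qed.

Lemma poly_bounded_time_bound e : poly_bounded (time_bound e).
Proof.
elim: e => /= [|b|e1 H1 e2 H2|v|e H e0 H0 e1 H1|e H e' H' e1 H1 e2 H2];
  try exact: poly_bounded_const.
- exact: poly_bounded_add.
- by apply: poly_bounded_add (poly_bounded_const 4); apply: poly_bounded_mul (poly_bounded_const 3) poly_bounded_id.
- have Hs := poly_bounded_size_bound e; have Hm := poly_bounded_add poly_bounded_id Hs.
  apply: poly_bounded_add H _; apply: poly_bounded_add (poly_bounded_const 2).
  apply: poly_bounded_mul Hs _; apply: poly_bounded_add (poly_bounded_const 3).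
  by apply: poly_bounded_add; [apply: (poly_bounded_comp H0 Hm) | apply: (poly_bounded_comp H1 Hm)].
have Hs := poly_bounded_size_bound e; have Hs' := poly_bounded_size_bound e'; have H1' := poly_bounded_const 1.
apply: poly_bounded_add H _; apply: poly_bounded_add H' _; apply: poly_bounded_add; last first.
  by apply: poly_bounded_add H1'; apply: poly_bounded_add.
apply: poly_bounded_add; apply: poly_bounded_mul (poly_bounded_const _) _; apply: poly_bounded_add H1' => //.
exact: poly_bounded_add.
Qed.

(** * From addressed code to machines with finitely many states *)

Definition target (i : instr) : nat :=
  maxn (i.2 None).2 (maxn (i.2 (Some true)).2 (i.2 (Some false)).2).

Lemma leq_target i r : (i.2 r).2 <= target i.
Proof. by rewrite /target !leq_max; case: r => [[]|]; rewrite leqnn ?orbT. Qed.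

Lemma leq_bigmax_nth (T : Type) (x0 : T) (s : seq T) (F : T -> nat) i :
  i < size s -> F (nth x0 s i) <= \max_(x <- s) F x.
Proof.
move=> lt_i; rewrite (big_nth x0) big_mkord.
exact: (leq_bigmax (F := fun j : 'I_(size s) => F (nth x0 s j)) (Ordinal lt_i)).
Qed.

Section CodeMachine.
Variable C : code.

Let tapes := \max_(i <- C) i.1.
Let states := maxn (size C) (\max_(i <- C) target i).

(* The machine accepts by halting just after the last instruction, and rejects
   by jumping further. *)
Definition code_machine : machine :=
  @Machine 'I_states.+1 void tapes ord0
    (fun q => size C <= q) (fun q => q == size C :> nat)
    (fun q h =>
       let: (v, f) := nth noop C q in
       let: a := f (rd (h (inord v))) in
       (inord a.2, [ffun i : 'I_tapes.+1 =>
                      if i == v :> nat then (wr a.1.1, a.1.2)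
                      else (h i, MoveStay)])).

Definition sim (c : config code_machine) (d : conf) : Prop :=
  c.1 = d.1 :> nat /\ forall i, c.2 i = d.2 i.

Lemma sim_step c d : sim c d -> sim (step c) (exec C d).
Proof.
case: c d => [q ts] [pc us] [/= Eq Et]; rewrite /exec -Eq.
case: ifP => // /negbT; rewrite -ltnNge => lt_q.
have := leq_bigmax_nth noop fst lt_q; have := leq_bigmax_nth noop target lt_q.
case: (nth noop C q) => [v f] le_t le_v.
have {}le_t r : (f r).2 <= states.
  by rewrite leq_max (leq_trans (leq_target (v, f) r) le_t) orbT.
split=> [|i] /=; first by rewrite ffunE Et inordK // inordK // ltnS.
rewrite !ffunE; case: eqP => [Ei|_]; last by rewrite Et /=; case: (us i).
by rewrite !Et inordK // Ei.
Qed.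

Lemma sim_iter n c d : sim c d -> sim (iter n (@step _) c) (iter n (exec C) d).
Proof. by elim: n c d => // n IHn c d H; apply: sim_step; exact: IHn. Qed.

Lemma run_code inputs m n pc ts :
  iter m (exec C) (0, fun j => load void (nth [::] inputs j)) = (pc, ts) ->
  m <= n -> size C <= pc ->
  sim (run code_machine n inputs) (pc, ts).
Proof.
move=> E le_mn le_pc.
have -> : (pc, ts) = iter n (exec C) (0, fun j => load void (nth [::] inputs j)).
  rewrite -(subnK le_mn) iterD E; elim: (n - m) => // k IHk.
  by rewrite iterS -IHk /exec le_pc.
by apply: sim_iter; split=> //= i; rewrite ffunE.
Qed.
End CodeMachine.

(** Inputs are loaded with the head on their first symbol, whereas stacks have it behind the last
    one. *)
Definition scan v pc : code :=
  [:: (v, fun r => if r is Some b then (r, MoveRight, pc)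
                   else (r, MoveStay, pc.+1))].

Lemma scan_right C pc v s1 s2 ts : code_at C pc (scan v pc) -> mid s1 s2 (ts v) ->
  exists ts', [/\ iter (size s2).+1 (exec C) (pc, ts) = (pc.+1, ts'),
    rest (s1 ++ s2) (ts' v) & forall j, j != v -> ts' j = ts j].
Proof.
move=> H; elim: s2 s1 ts => [|c s2 IHs] s1 ts Hv.
  eexists; split; first by rewrite /= (exec_at _ H) (mid_head Hv).
    by rewrite /= eqxx cats0; exact: mid_stay Hv.
  by move=> j /= /negPf ->.
pose ts1 := fun j => if j == v then act (wr (Some c), MoveRight) (ts j) else ts j.
have [|ts' [E R F]] := IHs (rcons s1 c) ts1; first by rewrite /ts1 eqxx; exact: mid_right.
exists ts'; rewrite -cat_rcons; split=> [||j jv] //; last by rewrite F // /ts1 (negPf jv).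
by rewrite iterSr (exec_at _ H) (mid_head Hv).
Qed.

Lemma mid_load s : mid [::] s (load void s).
Proof. by exists 0, 0; rewrite /load /= cats0. Qed.

Lemma mid_unload s t : mid [::] s t -> unload t = s.
Proof.
case=> a [b ->]; rewrite /unload /=.
have B k : read_bits (nseq k (@blank void)) = [::] by case: k.
by case: s => [|c s] //=; congr cons; elim: s => //= d s ->.
Qed.

(** Popping yields the last symbol first, so tape 0 is written leftwards; a final step to the right
    puts the head on the first symbol, where [unload] starts. *)
Definition move_out pc : code :=
  pop 1 pc (pc + 4) (pc + 2) (pc + 3) ++
  [:: (0, fun=> (Some false, MoveLeft, pc)); (0, fun=> (Some true, MoveLeft, pc));
      (0, fun=> (None, MoveRight, pc + 5))].

Lemma move_outP C pc s s' ts : code_at C pc (move_out pc) ->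
  rest s (ts 1) -> before s' (ts 0) ->
  exists m ts', [/\ m <= 3 * size s + 3,
    iter m (exec C) (pc, ts) = (pc + 5, ts') & mid [::] (s ++ s') (ts' 0)].
Proof.
rewrite /move_out popE => /code_at_cons[H0 /code_at_cons[H1 /code_at_cons[H2 /code_at_cons[H3 H4]]]].
elim/last_ind: s s' ts => [|s c IHs] s' ts R1 R0.
  exists 3; eexists; split=> [//||].
    rewrite /= (exec_at _ H0) (mid_head R1) (exec_at _ H1) /=.
    rewrite (before_head (mid_left0 R1)) (_ : pc + 4 = pc.+4) ?addn4 //.
    by rewrite (exec_at _ H4).
  exact: before_right R0.
have R1' := mid_left R1.
pose ts1 := fun j => if j == 1 then act (wr None, MoveLeft) (ts j) else ts j.
pose ts2 := fun j => if j == 1 then act (wr None, MoveStay) (ts1 j) else ts1 j.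
pose us := fun j => if j == 0 then act (wr (Some c), MoveLeft) (ts2 j) else ts2 j.
have E : iter 3 (exec C) (pc, ts) = (pc, us).
  rewrite /= (exec_at _ H0) (mid_head R1) (exec_at _ H1) /= (mid_head R1') /=.
  by rewrite /us /ts2 /ts1 addn2 addn3; case: (c); [rewrite (exec_at _ H3) | rewrite (exec_at _ H2)].
have [||m [ts' [le_m E' R']]] := IHs (c :: s') us.
- exact: mid_erase R1'.
- exact: before_write R0.
exists (m + 3), ts'; rewrite iterD E E' cat_rcons size_rcons; split=> //; lia.
Qed.

Theorem polytime_fun_eval e : polytime_fun (fun x => eval [:: x] e).
Proof.
pose l := 1 + code_length e.
(* Tape 0 holds the input, tape 1 receives the value, and temporaries start at tape 2. Tape 0 must
   be cleared before the result is moved there. *)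
pose C := scan 0 0 ++ comp [:: 0] 1 2 1 e ++ clear 0 l ++ move_out l.+2.
have HC : code_at C 0 C by exists [::], [::]; rewrite cats0.
have [H1 /code_at_cat[H2 /code_at_cat[H3 H4]]] := code_at_cat HC.
rewrite size_comp /clear size_pop -[_ + code_length e]/l -/(clear 0 l) addn2 in H3 H4.
have [p Hp] : poly_bounded (fun n => n + 1 + (time_bound e n + (2 * n + 2 + (3 * size_bound e n + 3)))).
  apply: poly_bounded_add; first exact: poly_bounded_add poly_bounded_id (poly_bounded_const _).
  apply: poly_bounded_add (poly_bounded_time_bound e) _; apply: poly_bounded_add;
    apply: poly_bounded_add (poly_bounded_const _); apply: poly_bounded_mul (poly_bounded_const _) _.
    exact: poly_bounded_id.
  exact: poly_bounded_size_bound.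
exists (code_machine C), p => x /=.
set s := eval [:: x] e.
pose ts0 := fun j => load void (nth [::] [:: x] j).
have [ts1 [E1 R1 F1]] := scan_right (ts := ts0) H1 (mid_load x).
pose g := fun j => if j == 0 then x else [::].
have Rg : repr g ts1.
  move=> j; rewrite /g; case: eqP => [-> //|/eqP j0]; rewrite F1 // /ts0.
  by case: j j0 => // j _; rewrite /= nth_nil; exact: mid_load.
have bx : bounded (map g [:: 0]) (size x) by rewrite /= leqnn.
have [//|//|//|[|[]] //|m2 [ts2 [le2 E2 R2]]] := spec_comp H2 _ _ _ _ bx Rg.
rewrite /= -/s in E2 R2.
have [m3 [ts3 [le3 E3 R3]]] := spec_clear H3 R2.
have R30 := R3 0; have R31 := R3 1; rewrite /upd /= in R30 R31.
have [m4 [ts4 [le4 E4 R4]]] := move_outP H4 R31 (rest_before R30).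
rewrite cats0 in R4.
have E : iter (m4 + (m3 + (m2 + (size x).+1))) (exec C) (0, ts0) = (l.+2 + 5, ts4).
  by rewrite !iterD E1 E2 E3 E4.
have le_C : size C <= l.+2 + 5.
  by rewrite /C /move_out /clear !(size_cat, size_comp, size_pop) /= /l; lia.
have [|Ec Et] := run_code (n := p.[size x]%R) E _ le_C.
  apply: leq_trans (Hp _); move: le2 le3 le4 (size_eval e bx).
  by rewrite /upd /g /= -/s; lia.
split; first by rewrite Ec.
by rewrite Et; exact: mid_unload.
Qed.

Theorem polytime_rel_eval e : polytime_rel (fun x y => eval [:: x; y] e != [::]).
Proof.
pose l := 2 + code_length e.
(* The final pop jumps to [l.+2], just after the code, on a nonempty value, and to [l.+3], which
   rejects, on an empty one. *)
pose C := scan 0 0 ++ scan 1 1 ++ comp [:: 0; 1] 2 3 2 e ++ pop 2 l l.+3 l.+2 l.+2.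
have HC : code_at C 0 C by exists [::], [::]; rewrite cats0.
have [H0 /code_at_cat[H1 /code_at_cat[H2 H3]]] := code_at_cat HC.
rewrite /= size_comp -[_ + code_length e]/l in H2 H3.
have [p Hp] : poly_bounded (fun n => n + 2 + (time_bound e n + 2)).
  by apply: poly_bounded_add; apply: poly_bounded_add (poly_bounded_const _);
    [exact: poly_bounded_id | exact: poly_bounded_time_bound].
exists (code_machine C), p => x y c.
set s := eval [:: x; y] e.
pose ts0 := fun j => load void (nth [::] [:: x; y] j).
have [ts1 [E0 R0 F0]] := scan_right (ts := ts0) H0 (mid_load x).
have R1 : mid [::] y (ts1 1) by rewrite F0 //; exact: mid_load.
have [ts2 [E1 {}R1 F1]] := scan_right (ts := ts1) H1 R1.
pose g := fun j => if j == 0 then x else if j == 1 then y else [::].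
have Rg : repr g ts2.
  move=> j; rewrite /g; have [->|j1] := eqVneq j 1; first exact: R1.
  rewrite F1 //; case: eqP => [-> //|/eqP j0]; rewrite F0 // /ts0.
  by case: j j0 j1 => [|[]] // j _ _; rewrite /= nth_nil; exact: mid_load.
have bxy : bounded (map g [:: 0; 1]) (size x + size y) by rewrite /= leq_addr leq_addl.
have [//|//|//|[|[|[]]] //|m2 [ts3 [le2 E2 R2]]] := spec_comp H2 _ _ _ _ bxy Rg.
rewrite /= -/s in E2 R2.
have E : iter (m2 + ((size y).+1 + (size x).+1)) (exec C) (0, ts0) = (l, ts3).
  by rewrite !iterD E0 E1 E2.
have le_C : size C = l.+2.
  by rewrite /C !(size_cat, size_comp, size_pop) /= /l; lia.
have [m3 [ts4 [le3 E3]]] : exists m ts', m <= 2 /\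
    iter m (exec C) (l, ts3) = (if s == [::] then l.+3 else l.+2, ts').
  have gs u : s = u -> upd g 2 s 2 = u by move=> <-.
  have [Es|[s' [b Es]]] : s = [::] \/ exists s' b, s = rcons s' b.
    by case: (lastP s) => [|s' b]; [left | right; exists s', b].
    have [m3 [ts4 [le3 E3 _]]] := spec_pop0 H3 (gs _ Es) R2.
    by exists m3, ts4; rewrite Es.
  have [m3 [ts4 [le3 E3 _]]] := spec_pop1 H3 (gs _ Es) R2; exists m3, ts4.
  by rewrite if_same in E3; rewrite E3 Es; case: (s').
have {}E : iter (m3 + (m2 + ((size y).+1 + (size x).+1))) (exec C) (0, ts0)
   = (if s == [::] then l.+3 else l.+2, ts4) by rewrite iterD E E3.
have [||Ec _] := run_code (n := p.[(size x + size y)%N]%R) E.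
- by apply: leq_trans (Hp _); lia.
- by rewrite le_C; case: ifP => _; lia.
change (size C <= c.1 /\ (c.1 == size C :> nat) = (s != [::])).
by rewrite Ec le_C /=; case: (s == [::]); split; rewrite ?eqxx; lia.
Qed.

Fixpoint ren (f : nat -> nat) (e : exp) : exp :=
  let up v := if v is v'.+1 then (f v').+1 else 0 in
  match e with
  | Skip => Skip
  | Emit b => Emit b
  | Cat e1 e2 => Cat (ren f e1) (ren f e2)
  | Var v => Var (f v)
  | Loop e e0 e1 => Loop (ren f e) (ren up e0) (ren up e1)
  | IfLe e e' e1 e2 => IfLe (ren f e) (ren f e') (ren f e1) (ren f e2)
  end.

Lemma eq_back f g : f =2 g -> back f =1 back g.
Proof. by move=> E; elim=> //= b r ->; rewrite E. Qed.

Lemma eval_ren f env env' e :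
  (forall v, nth [::] env' (f v) = nth [::] env v) ->
  eval env' (ren f e) = eval env e.
Proof.
elim: e f env env' => //= [e1 IH1 e2 IH2|e IH e0 IH0 e1 IH1|e IH e' IH' e1 IH1 e2 IH2] f env env' H.
- by rewrite (IH1 f env) // (IH2 f env).
- rewrite (IH f env) //; apply: eq_back => s b.
  by rewrite (IH0 _ (s :: env)) ?(IH1 _ (s :: env)) //; case.
by rewrite (IH f env) // (IH' f env) // (IH1 f env) // (IH2 f env).
Qed.

(** * Functions and predicates computed by expressions *)

Definition str_expr (X : Type) (vs : seq (X -> seq bool)) (F : X -> seq bool) : Prop :=
  exists e, forall x, eval [seq v x | v <- vs] e = F x.

(* A number is represented by any string of that length, and truth by any
   nonempty string. *)
Definition nat_expr (X : Type) (vs : seq (X -> seq bool)) (f : X -> nat) : Prop :=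
  exists e, forall x, size (eval [seq v x | v <- vs] e) = f x.

Definition bool_expr (X : Type) (vs : seq (X -> seq bool)) (b : X -> bool) : Prop :=
  exists e, forall x, (0 < size (eval [seq v x | v <- vs] e)) = b x.

(** A loop over a string of ones binds variable 0 to its proper prefixes, that is, to the indices in
    unary. *)
Definition ext (X : Type) (vs : seq (X -> seq bool)) : seq (X * nat -> seq bool) :=
  (fun p => nseq p.2 true) :: [seq (fun p => v p.1) | v <- vs].

Section Closure.
Variables (X : Type) (vs : seq (X -> seq bool)).
Implicit Types (F G : X -> seq bool) (f g : X -> nat) (b c : X -> bool).

Lemma str_expr_ext F G : F =1 G -> str_expr vs F -> str_expr vs G.
Proof. by move=> E [e He]; exists e => x; rewrite He E. Qed.

Lemma nat_expr_ext f g : f =1 g -> nat_expr vs f -> nat_expr vs g.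
Proof. by move=> E [e He]; exists e => x; rewrite He E. Qed.

Lemma bool_expr_ext b c : b =1 c -> bool_expr vs b -> bool_expr vs c.
Proof. by move=> E [e He]; exists e => x; rewrite He E. Qed.

Lemma eval_wk e (x : X) i :
  eval [seq v (x, i) | v <- ext vs] (ren succn e) = eval [seq v x | v <- vs] e.
Proof. by apply: eval_ren => v; rewrite /= -map_comp. Qed.

Lemma str_expr_wk F : str_expr vs F -> str_expr (ext vs) (fun p => F p.1).
Proof. by move=> [e He]; exists (ren succn e) => -[x i]; rewrite eval_wk He. Qed.

Lemma nat_expr_wk f : nat_expr vs f -> nat_expr (ext vs) (fun p => f p.1).
Proof. by move=> [e He]; exists (ren succn e) => -[x i]; rewrite eval_wk He. Qed.

Lemma bool_expr_wk b : bool_expr vs b -> bool_expr (ext vs) (fun p => b p.1).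
Proof. by move=> [e He]; exists (ren succn e) => -[x i]; rewrite eval_wk He. Qed.

Lemma nat_expr_idx : nat_expr (ext vs) (fun p => p.2).
Proof. by exists (Var 0) => -[x i]; rewrite /= size_nseq. Qed.

Lemma str_expr_cat F G : str_expr vs F -> str_expr vs G -> str_expr vs (fun x => F x ++ G x).
Proof. by move=> [e He] [e' He']; exists (Cat e e') => x; rewrite /= He He'. Qed.

Lemma str_expr_cons (c : bool) F : str_expr vs F -> str_expr vs (fun x => c :: F x).
Proof. by move=> [e He]; exists (Cat (Emit c) e) => x; rewrite /= He. Qed.

Lemma str_expr_lit (w : seq bool) : str_expr vs (fun=> w).
Proof.
elim: w => [|b w [e He]]; first by exists Skip.
by exists (Cat (Emit b) e) => x; rewrite /= He.
Qed.

Lemma back_nseq (c : bool) (w : seq bool) :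
  back (fun _ a => if a then [:: c] else [:: c]) (rev w) = nseq (size w) c.
Proof. by rewrite -size_rev; elim: (rev w) => //= -[] r ->. Qed.

Lemma str_expr_nseq f (c : bool) : nat_expr vs f -> str_expr vs (fun x => nseq (f x) c).
Proof.
by move=> [e He]; exists (Loop e (Emit c) (Emit c)) => x; rewrite /= -He back_nseq.
Qed.

Lemma str_expr_if b F G : bool_expr vs b -> str_expr vs F -> str_expr vs G ->
  str_expr vs (fun x => if b x then F x else G x).
Proof.
move=> [e He] [e1 H1] [e2 H2]; exists (IfLe e Skip e2 e1) => x /=.
by rewrite -He H1 H2; case: (eval _ e).
Qed.

(** The reversal comes from loops running from the last symbol; it is the reason why lists of edges
    and conflicts are generated over [rev (iota ...)] below. *)
Lemma str_expr_flatten f (B : X -> nat -> seq bool) :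
  nat_expr vs f -> str_expr (ext vs) (fun p => B p.1 p.2) ->
  str_expr vs (fun x => flatten [seq B x i | i <- rev (iota 0 (f x))]).
Proof.
move=> /(@str_expr_nseq _ true) [e He] [e' He']; exists (Loop e e' e') => x /=.
rewrite He; elim: (f x) => // n IHn.
have -> : nseq n.+1 true = rcons (nseq n true) true.
  by rewrite -cats1 -[[:: true]]/(nseq 1 true) -nseqD addn1.
rewrite back_rcons IHn -[in RHS]addn1 iotaD rev_cat /= add0n.
have := He' (x, n); rewrite /= -map_comp /= => <-.
by congr (eval _ _ ++ _).
Qed.

Lemma nat_expr_size F : str_expr vs F -> nat_expr vs (fun x => size (F x)).
Proof. by move=> [e He]; exists e => x; rewrite He. Qed.

Lemma nat_expr_const n : nat_expr vs (fun=> n).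
Proof. by have [e He] := str_expr_lit (nseq n true); exists e => x; rewrite He size_nseq. Qed.

Lemma nat_expr_add f g : nat_expr vs f -> nat_expr vs g -> nat_expr vs (fun x => f x + g x).
Proof. by move=> [e He] [e' He']; exists (Cat e e') => x; rewrite size_cat He He'. Qed.

Lemma nat_expr_S f : nat_expr vs f -> nat_expr vs (fun x => (f x).+1).
Proof. by move=> [e He]; exists (Cat (Emit true) e) => x; rewrite size_cat He. Qed.

Lemma nat_expr_sum f (g : X -> nat -> nat) :
  nat_expr vs f -> nat_expr (ext vs) (fun p => g p.1 p.2) ->
  nat_expr vs (fun x => sumn [seq g x i | i <- iota 0 (f x)]).
Proof.
move=> Hf [e' He'].
have [|e He] := @str_expr_flatten f (fun x i => eval [seq v (x, i) | v <- ext vs] e') Hf.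
  by exists e' => -[].
exists e => x; rewrite He size_flatten /shape -map_comp map_rev sumn_rev.
by congr sumn; apply: eq_map => i; exact: He' (x, i).
Qed.

Lemma nat_expr_mul f g : nat_expr vs f -> nat_expr vs g -> nat_expr vs (fun x => f x * g x).
Proof.
move=> Hf /nat_expr_wk Hg.
apply: nat_expr_ext (@nat_expr_sum f (fun x _ => g x) Hf Hg) => x.
by rewrite -[in RHS](size_iota 0 (f x)); elim: (iota _ _) => //= _ r ->.
Qed.

Lemma bool_expr_const (c : bool) : bool_expr vs (fun=> c).
Proof. by case: c; [exists (Emit true) | exists Skip]. Qed.

Lemma bool_expr_not b : bool_expr vs b -> bool_expr vs (fun x => ~~ b x).
Proof.
move=> [e He]; exists (IfLe e Skip (Emit true) Skip) => x /=.
by rewrite -He; case: (eval _ e).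
Qed.

Lemma bool_expr_if b c d : bool_expr vs b -> bool_expr vs c -> bool_expr vs d ->
  bool_expr vs (fun x => if b x then c x else d x).
Proof.
move=> [e He] [e1 H1] [e2 H2]; exists (IfLe e Skip e2 e1) => x /=.
by rewrite -He -H1 -H2; case: (eval _ e).
Qed.

Lemma bool_expr_and b c : bool_expr vs b -> bool_expr vs c -> bool_expr vs (fun x => b x && c x).
Proof. by move=> Hb Hc; apply: bool_expr_if Hb Hc (bool_expr_const false). Qed.

Lemma bool_expr_or b c : bool_expr vs b -> bool_expr vs c -> bool_expr vs (fun x => b x || c x).
Proof. by move=> Hb Hc; apply: bool_expr_if Hb (bool_expr_const true) Hc. Qed.

Lemma bool_expr_imp b c : bool_expr vs b -> bool_expr vs c -> bool_expr vs (fun x => b x ==> c x).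
Proof. by move=> Hb Hc; apply: bool_expr_if Hb Hc (bool_expr_const true). Qed.

Lemma bool_expr_le f g : nat_expr vs f -> nat_expr vs g -> bool_expr vs (fun x => f x <= g x).
Proof.
move=> [e He] [e' He']; exists (IfLe e e' (Emit true) Skip) => x /=.
by rewrite He He'; case: ifP.
Qed.

Lemma bool_expr_eq f g : nat_expr vs f -> nat_expr vs g -> bool_expr vs (fun x => f x == g x).
Proof.
move=> Hf Hg; apply: bool_expr_ext (bool_expr_and (bool_expr_le Hf Hg) (bool_expr_le Hg Hf)) => x.
by rewrite eqn_leq.
Qed.

Lemma nat_expr_count f (b : X -> nat -> bool) :
  nat_expr vs f -> bool_expr (ext vs) (fun p => b p.1 p.2) ->
  nat_expr vs (fun x => count (b x) (iota 0 (f x))).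
Proof.
move=> Hf [e He].
have Hb : nat_expr (ext vs) (fun p => b p.1 p.2 : nat).
  have [e1 H1] : str_expr (ext vs) (fun p => nseq (b p.1 p.2) true).
    exists (IfLe e Skip Skip (Emit true)) => p /=.
    by rewrite -He; case: (eval _ e).
  by exists e1 => p; rewrite H1 size_nseq.
by apply: nat_expr_ext (nat_expr_sum (g := fun x i => b x i : nat) Hf Hb) => x; rewrite sumn_count.
Qed.

Lemma bool_expr_has f (b : X -> nat -> bool) :
  nat_expr vs f -> bool_expr (ext vs) (fun p => b p.1 p.2) ->
  bool_expr vs (fun x => has (b x) (iota 0 (f x))).
Proof.
move=> Hf Hb; apply: bool_expr_ext (bool_expr_le (nat_expr_const 1) (nat_expr_count Hf Hb)) => x.
by rewrite has_count.
Qed.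

(** The truncated difference counts the [i < f x] with [g x <= i]. *)
Lemma nat_expr_sub f g : nat_expr vs f -> nat_expr vs g -> nat_expr vs (fun x => f x - g x).
Proof.
move=> Hf Hg.
apply: nat_expr_ext (@nat_expr_count f (fun x i => g x <= i) Hf _) => [x|]; last first.
  have [e1 H1] := nat_expr_wk Hg; have [e2 H2] := nat_expr_idx.
  by exists (IfLe e1 e2 (Emit true) Skip) => p /=; rewrite H1 H2; case: ifP.
elim: (f x) => // n IHn; rewrite -addn1 iotaD count_cat IHn /= add0n.
by case: leqP; lia.
Qed.

(** While the loop visits a symbol, the length of variable 0 is its position; a one is emitted when
    this length equals [f x], tested by two comparisons. Out of range nothing is emitted, which
    matches the default [false]. *)
Lemma bool_expr_nth F f : str_expr vs F -> nat_expr vs f -> bool_expr vs (fun x => nth false (F x) (f x)).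
Proof.
move=> [e He] [e' He'].
pose i := Var 0; pose e1 := ren succn e'.
exists (Loop e Skip (IfLe i e1 (IfLe e1 i (Emit true) Skip) Skip)) => x /=.
rewrite He; elim/last_ind: (F x) => [|s c IHs]; first by rewrite nth_nil.
rewrite back_rcons size_cat nth_rcons addn_gt0 IHs.
have -> : size (eval (s :: [seq v x | v <- vs]) e1) = f x.
  by rewrite -He'; congr size; apply: eval_ren.
case: c; rewrite /=; case: (ltngtP (f x) (size s)) => //= lt_s;
  by rewrite ?orbF // nth_default ?lt_s // ltnW.
Qed.
End Closure.

(* [block y j] is the length of the [j]-th block of ones of [y], the blocks being
   separated by zeros. *)
Definition zeros (y : seq bool) (i : nat) : nat :=
  count (fun k => ~~ nth false y k) (iota 0 i).
Definition block (y : seq bool) (j : nat) : nat :=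
  count (fun i => nth false y i && (zeros y i == j)) (iota 0 (size y)).

Lemma count_iota_shift (p : pred nat) a n :
  count p (iota a n) = count (fun k => p (a + k)) (iota 0 n).
Proof. by rewrite -{1}(addn0 a) iotaDl count_map. Qed.

Lemma nth_block n y k : nth false (nseq n true ++ false :: y) k =
  if k < n then true else if k == n then false else nth false y (k - n.+1).
Proof.
rewrite nth_cat size_nseq nth_nseq; case: ltnP => // le_n.
by case: eqP => [->|ne]; [rewrite subnn | rewrite (_ : k - n = (k - n.+1).+1); last lia].
Qed.

Lemma zeros_block n y i :
  zeros (nseq n true ++ false :: y) i = if i <= n then 0 else (zeros y (i - n.+1)).+1.
Proof.
rewrite /zeros; under eq_count => k do rewrite nth_block.
have Z a : a <= n -> count (fun k => ~~ (if k < n then true else if k == n then false else nth false y (k - n.+1))) (iota 0 a) = 0.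
  move=> le_a; rewrite (@eq_in_count _ _ pred0) ?count_pred0 // => k.
  by rewrite mem_iota /= => lt_k; rewrite (leq_trans lt_k le_a).
case: leqP => [|lt_i]; first exact: Z.
rewrite -[in LHS](subnKC lt_i) iotaD count_cat -[in iota 0 n.+1]addn1 iotaD count_cat Z //= add0n.
rewrite ltnn eqxx addn0 add0n add1n; congr _.+1.
rewrite count_iota_shift; apply: eq_count => k /=.
have [E1 E2 E3] : [/\ (n.+1 + k < n) = false, (n.+1 + k == n) = false & n.+1 + k - n.+1 = k].
  by split; lia.
by rewrite E1 E2 E3.
Qed.

Lemma block_cons n y j :
  block (nseq n true ++ false :: y) j = if j is j'.+1 then block y j' else n.
Proof.
rewrite /block; under eq_count => k do rewrite nth_block zeros_block.
rewrite size_cat size_nseq /= iotaD count_cat add0n -[(size y).+1]add1n iotaD count_cat.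
rewrite (@eq_in_count _ _ (fun=> j == 0)) => [|k]; last first.
  by rewrite mem_iota /= => lt_k; rewrite lt_k ltnW // eq_sym.
rewrite [count _ (iota n 1)]/= ltnn eqxx /= ?addn0 ?add0n.
rewrite (count_iota_shift _ (n + 1)) [X in _ + X](@eq_count _ _ (fun k => nth false y k && ((zeros y k).+1 == j))); last first.
  move=> k; cbv beta; have [E1 E2 E3 E4] : [/\ (n + 1 + k < n) = false, (n + 1 + k == n) = false,
      (n + 1 + k <= n) = false & n + 1 + k - n.+1 = k] by split; lia.
  by rewrite E1 E2 E3 E4.
case: j => [|j].
  by rewrite count_predT size_iota (@eq_count _ _ pred0) ?count_pred0 ?addn0 // => k; rewrite andbF.
by rewrite count_pred0.
Qed.

Lemma block_encode (s : seq nat) j : block (flatten (map encode_nat s)) j = nth 0 s j.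
Proof.
elim: s j => [|n s IHs] j; first by rewrite nth_nil.
rewrite /= /encode_nat -cats1 -catA block_cons.
by case: j => // j; rewrite IHs.
Qed.

Section Closure2.
Variables (X : Type) (vs : seq (X -> seq bool)).
Implicit Types (F G : X -> seq bool) (f g : X -> nat) (b c : X -> bool).

Lemma bool_expr_all f (b : X -> nat -> bool) :
  nat_expr vs f -> bool_expr (ext vs) (fun p => b p.1 p.2) ->
  bool_expr vs (fun x => all (b x) (iota 0 (f x))).
Proof.
move=> Hf /bool_expr_not Hb.
apply: bool_expr_ext (bool_expr_not (bool_expr_has (b := fun x i => ~~ b x i) Hf Hb)) => x.
by rewrite has_predC negbK.
Qed.

Lemma bool_expr_eqb b c : bool_expr vs b -> bool_expr vs c -> bool_expr vs (fun x => b x == c x).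
Proof.
move=> Hb Hc; apply: bool_expr_ext (bool_expr_if Hb Hc (bool_expr_not Hc)) => x.
by case: (b x); case: (c x).
Qed.

Lemma bool_expr_eqs F G : str_expr vs F -> str_expr vs G -> bool_expr vs (fun x => F x == G x).
Proof.
move=> HF HG.
have Hb : bool_expr (ext vs) (fun p => nth false (F p.1) p.2 == nth false (G p.1) p.2).
  have nthP (H : X -> seq bool) (HH : str_expr vs H) : bool_expr (ext vs) (fun p => nth false (H p.1) p.2).
    exact: (bool_expr_nth (str_expr_wk HH) (nat_expr_idx vs)).
  have H1 := nthP _ HF; have H2 := nthP _ HG.
  apply: bool_expr_ext (bool_expr_if H1 H2 (bool_expr_not H2)) => p.
  by case: (nth _ (F _) _); case: (nth _ (G _) _).
apply: bool_expr_ext (bool_expr_and (bool_expr_eq (nat_expr_size HF) (nat_expr_size HG))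
  (bool_expr_all (b := fun x i => nth false (F x) i == nth false (G x) i) (nat_expr_size HF) Hb)) => x.
apply/andP/eqP => [[/eqP Es /allP E]|->]; last first.
  by split=> //; apply/allP => i _.
by apply: (@eq_from_nth _ false) => // i lt_i; apply/eqP/E; rewrite mem_iota.
Qed.

(** The quotient counts the [i] with [i.+1 * g x <= f x]; the guard [0 < g x] reproduces the value 0
    of a division by zero. *)
Lemma nat_expr_div f g : nat_expr vs f -> nat_expr vs g -> nat_expr vs (fun x => f x %/ g x).
Proof.
move=> Hf Hg.
have Hb : bool_expr (ext vs) (fun p => (0 < g p.1) && (p.2.+1 * g p.1 <= f p.1)).
  apply: bool_expr_and; first exact: bool_expr_le (nat_expr_const _ _) (nat_expr_wk Hg).
  exact: bool_expr_le (nat_expr_mul (nat_expr_S (nat_expr_idx _)) (nat_expr_wk Hg)) (nat_expr_wk Hf).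
apply: nat_expr_ext (nat_expr_count (b := fun x i => (0 < g x) && (i.+1 * g x <= f x)) Hf Hb) => x.
have [->|g0] := posnP (g x); first by rewrite divn0 (@eq_count _ _ pred0) ?count_pred0.
under eq_count => i do rewrite -leq_divRL //=.
have := leq_div (f x) (g x); move: (f x %/ g x) => q le_q.
rewrite -(subnKC le_q) iotaD count_cat (@eq_in_count _ _ predT); last first.
  by move=> i; rewrite mem_iota.
rewrite count_predT size_iota (@eq_in_count _ _ pred0) ?count_pred0 ?addn0 // => i.
by rewrite mem_iota add0n => /andP[le_i _]; rewrite ltnNge le_i.
Qed.

Lemma nat_expr_mod f g : nat_expr vs f -> nat_expr vs g -> nat_expr vs (fun x => f x %% g x).
Proof.
move=> Hf Hg; apply: nat_expr_ext (nat_expr_sub Hf (nat_expr_mul (nat_expr_div Hf Hg) Hg)) => x.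
by rewrite {1}(divn_eq (f x) (g x)) addKn.
Qed.

Lemma nat_expr_horner (p : {poly nat}) f : nat_expr vs f -> nat_expr vs (fun x => p.[f x]%R).
Proof.
move=> Hf; elim/poly_ind: p => [|p c IHp].
  by apply: nat_expr_ext (nat_expr_const vs 0) => x; rewrite horner0.
by apply: nat_expr_ext (nat_expr_add (nat_expr_mul IHp Hf) (nat_expr_const vs c)) => x; rewrite hornerMXaddC.
Qed.

(** The list does not depend on the input, so the conjunction is unrolled inside the expression and
    its elements may have any type. *)
Lemma bool_expr_all_const (T : Type) (s : seq T) (b : T -> X -> bool) :
  (forall t, bool_expr vs (b t)) -> bool_expr vs (fun x => all (b^~ x) s).
Proof.
move=> Hb; elim: s => [|t s IHs]; first exact: bool_expr_const.
exact: (bool_expr_and (Hb t) IHs).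
Qed.

Lemma nat_expr_block F f : str_expr vs F -> nat_expr vs f -> nat_expr vs (fun x => block (F x) (f x)).
Proof.
move=> HF Hf; have HF1 := str_expr_wk HF; have HF2 := str_expr_wk HF1.
have Hz : nat_expr (ext vs) (fun p => zeros (F p.1) p.2).
  apply: (@nat_expr_count _ (ext vs) (fun p => p.2) (fun p k => ~~ nth false (F p.1) k)).
    exact: nat_expr_idx.
  exact: bool_expr_not (bool_expr_nth HF2 (nat_expr_idx _)).
apply: (nat_expr_count (b := fun x i => nth false (F x) i && (zeros (F x) i == f x))).
  exact: nat_expr_size.
exact: bool_expr_and (bool_expr_nth HF1 (nat_expr_idx _)) (bool_expr_eq Hz (nat_expr_wk Hf)).
Qed.
End Closure2.

(** The argument [d] bounds the number of bound indices through which a hypothesis is weakened. *)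
Ltac leaf_from H d :=
  first [ exact H
        | lazymatch d with
          | S ?d' => first [ leaf_from constr:(nat_expr_wk H) d'
                           | leaf_from constr:(str_expr_wk H) d'
                           | leaf_from constr:(bool_expr_wk H) d' ]
          end ].

Ltac leaf :=
  match goal with
  | H : str_expr _ _ |- _ => leaf_from H 4
  | H : nat_expr _ _ |- _ => leaf_from H 4
  | H : bool_expr _ _ |- _ => leaf_from H 4
  | |- nat_expr (ext ?vs) _ => leaf_from (nat_expr_idx vs) 4
  | |- nat_expr (ext (ext ?vs)) _ => leaf_from (nat_expr_idx vs) 4
  | |- nat_expr (ext (ext (ext ?vs))) _ => leaf_from (nat_expr_idx vs) 4
  end.

Ltac closure_step :=
  cbv beta;
  lazymatch goal with
  | |- nat_expr _ _ => first [ apply: nat_expr_const | leaf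
      | apply: nat_expr_block | apply: nat_expr_S
      | apply: nat_expr_add | apply: nat_expr_mul | apply: nat_expr_sub | apply: nat_expr_div
      | apply: nat_expr_mod | apply: nat_expr_horner | apply: nat_expr_size
      | apply: nat_expr_count ]
  | |- bool_expr _ _ => first [ apply: bool_expr_const | leaf
      | apply: bool_expr_and | apply: bool_expr_or | apply: bool_expr_imp
      | apply: bool_expr_not | apply: bool_expr_le | apply: bool_expr_eq
      | apply: bool_expr_eqs | apply: bool_expr_eqb | apply: bool_expr_all
      | apply: bool_expr_has | apply: bool_expr_nth | apply: bool_expr_if ]
  | |- str_expr _ _ => first [ apply: str_expr_lit | leaf | apply: str_expr_cons
      | apply: str_expr_cat | apply: str_expr_nseq | apply: str_expr_flatten
      | apply: str_expr_if ]
  end.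

Ltac closure := repeat closure_step.

(** * Spanning trees given by parents *)

Section ParentTree.
Variables (V : finType) (r : V).
Implicit Types (E T : {set {set V}}) (par : V -> V) (d : V -> nat).

Definition parent_tree par : {set {set V}} := [set [set v; par v] | v : V & v != r].

Lemma adj_sym T : symmetric (adj T).
Proof. by move=> x y; rewrite /adj /= eq_sym setUC. Qed.

Lemma eq_pair (a b c e : V) : [set a; b] = [set c; e] ->
  (a = c /\ b = e) \/ (a = e /\ b = c).
Proof.
move=> E; have := set21 a b; rewrite E !inE => Ha; have := set22 a b; rewrite E !inE => Hb.
have := set21 c e; rewrite -E !inE => Hc; have := set22 c e; rewrite -E !inE => He.
by case/orP: Ha => /eqP Ea; case/orP: Hb => /eqP Eb; case/orP: Hc => /eqP Ec;
  case/orP: He => /eqP Ee; intuition congruence.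
Qed.

Lemma parent_tree_connected par d :
  (forall v, v != r -> d (par v) < d v) -> connected_graph (parent_tree par).
Proof.
move=> dec; have sym := sym_connect_sym (adj_sym (parent_tree par)).
have toR v : connect (adj (parent_tree par)) v r.
  have [n] := ubnP (d v); elim: n v => // n IHn v lt_n.
  have [->|vr] := eqVneq v r; first exact: connect0.
  apply: connect_trans (IHn (par v) _); last exact: leq_trans (dec v vr) lt_n.
  apply: connect1; apply/andP; split; last by apply/imsetP; exists v; rewrite ?inE.
  by apply: contraTneq (dec v vr) => <-; rewrite ltnn.
by move=> x y; apply: connect_trans (toR x) _; rewrite sym.
Qed.

(** At a vertex of maximal [d] on a cycle, both neighbours on the cycle must be its parent; on a
    cycle of length at least 3 they are distinct. *)
Lemma parent_tree_acyclic par d :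
  (forall v, v != r -> d (par v) < d v) -> acyclic_graph (parent_tree par).
Proof.
move=> dec c lt_c; rewrite /ucycle => /andP[cyc_c uniq_c].
case: c lt_c cyc_c uniq_c => // x0 c0; set c := x0 :: c0 => lt_c cyc_c uniq_c.
have x0c : x0 \in c by rewrite mem_head.
case: (@arg_maxnP _ x0 (mem c) d x0c) => x xc max_x.
have [i c' Ec] := rot_to xc.
move: lt_c cyc_c uniq_c; rewrite -(size_rot i) -(rot_cycle i) -(rot_uniq i) Ec.
have {}max_x y : y \in x :: c' -> d y <= d x.
  by rewrite -Ec mem_rot; exact: max_x.
case: c' {Ec} max_x => [|y [|z c']] //= max_x _.
rewrite rcons_path => /andP[xy /andP[_ /andP[_ wx]]] /and3P[_ y_notin _].
have nbr u : u \in [:: x, y, z & c'] -> adj (parent_tree par) x u -> u = par x.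
  move=> uc /andP[_ /imsetP[v]]; rewrite inE => vr /eq_pair[[-> ->] //|[Ex Eu]].
  by have := dec v vr; rewrite -Ex -Eu ltnNge max_x.
have Ey : y = par x by apply: nbr; rewrite ?inE ?eqxx ?orbT.
have Ew : last z c' = par x.
  by apply: nbr; rewrite 1?adj_sym // inE; rewrite inE mem_last !orbT.
by rewrite Ey -Ew mem_last in y_notin.
Qed.

(** Take for [d] the distance from [r]: the last but one vertex of a shortest path is a neighbour at
    smaller distance, so the default in [par] is never taken when [v != r]. *)
Lemma connected_parent T : connected_graph T ->
  exists par d, forall v, v != r -> [set v; par v] \in T /\ d (par v) < d v.
Proof.
move=> conn.
pose D v n := [exists p : n.-tuple V, path (adj T) r p && (last r p == v)].
have exD v : exists n, D v n.
  have /connectP[p pp ->] := conn r v; exists (size p).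
  by apply/existsP; exists (in_tuple p); rewrite /= pp eqxx.
pose d v := ex_minn (exD v).
pose par v := odflt v [pick u | ([set v; u] \in T) && (d u < d v)].
exists par, d => v vr; rewrite /par; case: pickP => [u /andP[] //|none].
exfalso; have : D v (d v) by rewrite /d; case: ex_minnP.
case/existsP=> -[p /= /eqP sp] /andP[].
case/lastP: p sp => [|p u] sp; first by move=> _ /eqP vE; rewrite -vE eqxx in vr.
rewrite rcons_path last_rcons => /andP[pp adju] /eqP Eu; subst u.
have := none (last r p); rewrite setUC; case/andP: adju => _ -> /=.
rewrite /d; case: ex_minnP => m _ /(_ (size p)) le_m.
have /le_m lt_m : D (last r p) (size p).
  by apply/existsP; exists (in_tuple p); rewrite /= pp eqxx.
by move: sp; rewrite size_rcons /d => <-; rewrite ltnS lt_m.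
Qed.

(** A decreasing height replaces connectedness and acyclicity. This form serves both as the
    certificate of the verifier and as the way to exhibit trees in the reduction. *)
Lemma FSTAC_parent E S : FSTAC E S <->
  exists par d, (forall v, v != r -> [set v; par v] \in E /\ d (par v) < d v)
    /\ avoids_conflicts S (parent_tree par).
Proof.
split=> [[T [[/subsetP subT conn _] avT]]|[par [d [H av]]]].
  have [par [d H]] := connected_parent conn.
  exists par, d; split=> [v /H[/subT]//|e f ef [eP fP]].
  have PT g : g \in parent_tree par -> g \in T.
    by case/imsetP=> v; rewrite inE => /H[? _] ->.
  by apply: (avT e f ef); split; exact: PT.
have dec v : v != r -> d (par v) < d v by case/H.
exists (parent_tree par); split=> //; split.
- by apply/subsetP => e /imsetP[v]; rewrite inE => /H[? _] ->.
- exact: parent_tree_connected dec.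
exact: parent_tree_acyclic dec.
Qed.
End ParentTree.

(** * Membership in NP *)

(** Arithmetic form of the edges, taken with increasing endpoints: spokes have [i = 0], and the
    deleted path edges are those that start at a multiple of 3. *)
Definition fs_edge (i j : nat) : bool :=
  (i < j) && ((i == 0) || ((j == i.+1) && (i %% 3 != 0))).

Lemma fan_starP k e : reflect
  (exists i j : 'I_(3 * k).+1, fs_edge i j /\ e = [set i; j]) (e \in fan_star k).
Proof.
apply: (iffP idP) => [|[i [j [/andP[lt_ij /orP fs] ->]]]]; rewrite inE.
  case/andP=> notrem; rewrite inE => /orP[] /imsetP[i]; rewrite inE => i0 Ee.
    have lt_i := ltn_ord i.
    exists (inord i), (inord i.+1); split=> //; rewrite /fs_edge !inordK ?ltnS //; last exact: ltnW.
    rewrite leqnn eqxx /= orbC; apply/orP; left; apply/negP => /eqP i3.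
    have Ei := divn_eq i 3; rewrite i3 addn0 in Ei.
    have lt_q : i %/ 3 < k by lia.
    case/negP: notrem; apply/imsetP; exists (Ordinal lt_q); first by rewrite inE /=; lia.
    by rewrite Ee /=; have -> : 3 * (i %/ 3) = i by lia.
  by exists ord0, i; rewrite /fs_edge i0.
have lt_j := ltn_ord j; apply/andP; split; last first.
  rewrite inE; case: fs => [/eqP i0|/andP[/eqP Ej i3]]; apply/orP; [right|left].
    apply/imsetP; exists j; first by rewrite inE; lia.
    by congr [set _; _]; apply: val_inj.
  have lt_i : i < 3 * k by lia.
  apply/imsetP; exists (Ordinal lt_i); first by rewrite inE /=; case: (nat_of_ord i) i3.
  by congr [set _; _]; apply: val_inj; rewrite /= inordK //; lia.
apply/negP => /imsetP[q]; rewrite inE => q0 /eq_pair E.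
have lt_q := ltn_ord q.
have e1 : (inord (3 * q) : 'I_(3 * k).+1) = 3 * q :> nat by rewrite inordK //; lia.
have e2 : (inord (3 * q).+1 : 'I_(3 * k).+1) = (3 * q).+1 :> nat by rewrite inordK //; lia.
case: E => -[Ei Ej]; move: (congr1 val Ei) (congr1 val Ej) lt_ij fs => /=;
  rewrite e1 e2 => -> ->; last by lia.
by move=> _ [|/andP[_]]; rewrite ?modnMr //; lia.
Qed.

Lemma in_edge_set (I : instance) e :
  (e \in edge_set I) = (e \in [seq edge_of p | p <- edge_list I]).
Proof. by rewrite inE. Qed.

Lemma in_conflicts (I : instance) P :
  (P \in conflicts I) = (P \in [seq [set edge_of p.1; edge_of p.2] | p <- conflict_list I]).
Proof. by rewrite inE. Qed.

Section Check.
Variable F : nat -> nat -> nat.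

(* A certificate is a family of arrays [F t]: [F 0] holds the number [n] of
   vertices, the number [k] of triples and the lengths of the two lists; [F 1]
   and [F 2] hold the endpoints of the edges and [F 3], ..., [F 6] those of the
   conflicting edges; [F 7] is an isomorphism from the standard fan-star, and
   [F 8], [F 9] give the parent and the height of a vertex in a spanning tree
   rooted at vertex 0. *)
Let n := F 0 0.
Let k := F 0 1.
Let m := F 0 2.
Let c := F 0 3.

Definition same (a b a' b' : nat) : bool :=
  ((a == a') && (b == b')) || ((a == b') && (b == a')).
Definition in_edges a b : bool := has (fun j => same a b (F 1 j) (F 2 j)) (iota 0 m).
Definition in_tree a b : bool :=
  ((a != 0) && (F 8 a == b)) || ((b != 0) && (F 8 b == a)).

Definition check_edges : bool :=
  all (fun j => (F 1 j < n) && ((F 2 j < n) && (F 1 j != F 2 j))) (iota 0 m).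
Definition check_conflicts : bool :=
  all (fun j =>
    ((F 3 j < n) && (F 4 j < n) && (F 5 j < n) && (F 6 j < n)) &&
    (in_edges (F 3 j) (F 4 j) && in_edges (F 5 j) (F 6 j)) &&
    ~~ same (F 3 j) (F 4 j) (F 5 j) (F 6 j) &&
    ((F 3 j == F 5 j) || (F 3 j == F 6 j) || (F 4 j == F 5 j) || (F 4 j == F 6 j)) &&
    ~~ (in_tree (F 3 j) (F 4 j) && in_tree (F 5 j) (F 6 j))) (iota 0 c).
Definition check_star : bool :=
  all (fun i => (F 7 i < n) &&
     all (fun j => (F 7 i == F 7 j) ==> (i == j)) (iota 0 n)) (iota 0 n) &&
  (all (fun j => has (fun a => has (fun b =>
     fs_edge a b && same (F 1 j) (F 2 j) (F 7 a) (F 7 b)) (iota 0 n)) (iota 0 n)) (iota 0 m) &&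
   all (fun a => all (fun b =>
     fs_edge a b ==> in_edges (F 7 a) (F 7 b)) (iota 0 n)) (iota 0 n)).
Definition check_tree : bool :=
  all (fun i => (i != 0) ==>
     ((F 8 i < n) && ((F 9 (F 8 i) < F 9 i) && in_edges i (F 8 i)))) (iota 0 n).

Definition check : bool :=
  ((0 < k) && (n == (3 * k).+1)) &&
  (check_edges && (check_conflicts && (check_star && check_tree))).

(** The code of the instance described by the arrays. Comparing it with the input replaces
    decoding. *)
Definition gen : seq bool :=
  (nseq n true ++ [:: false]) ++
  ((flatten [seq true :: ((nseq (F 1 j) true ++ [:: false]) ++ (nseq (F 2 j) true ++ [:: false]))
      | j <- rev (iota 0 m)] ++ [:: false]) ++
   (flatten [seq true :: (((nseq (F 3 j) true ++ [:: false]) ++ (nseq (F 4 j) true ++ [:: false])) ++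
                          ((nseq (F 5 j) true ++ [:: false]) ++ (nseq (F 6 j) true ++ [:: false])))
      | j <- rev (iota 0 c)] ++ [:: false])).
End Check.

Lemma allI (p : pred nat) n : reflect (forall i, i < n -> p i) (all p (iota 0 n)).
Proof.
by apply: (iffP allP) => H i; [move=> lt_i; apply: H | move=> /[!mem_iota] lt_i; apply: H];
  rewrite ?mem_iota.
Qed.

Lemma hasI (p : pred nat) n : reflect (exists2 i, i < n & p i) (has p (iota 0 n)).
Proof.
by apply: (iffP hasP) => -[i lt_i pi]; exists i => //; move: lt_i; rewrite mem_iota.
Qed.

Lemma inord_pair N (a b a' b' : nat) : a < N.+1 -> b < N.+1 -> a' < N.+1 -> b' < N.+1 ->
  ([set inord a; inord b] == [set inord a'; inord b' : 'I_N.+1]) = same a b a' b'.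
Proof.
move=> la lb la' lb'; apply/eqP/idP => [/eq_pair E|/orP[] /andP[/eqP-> /eqP->] //].
  have inj x y : x < N.+1 -> y < N.+1 -> (inord x : 'I_N.+1) = inord y -> x = y.
    by move=> lx ly /(congr1 val) /=; rewrite !inordK.
  rewrite /same; case: E => -[/inj-> // /inj-> //]; rewrite !eqxx ?orbT //.
by rewrite setUC.
Qed.

Lemma encode_seqE (A : Type) (enc : A -> seq bool) s :
  encode_seq enc s = flatten [seq true :: enc a | a <- s] ++ [:: false].
Proof. by rewrite /encode_seq cats1. Qed.

Lemma encode_natE n : encode_nat n = nseq n true ++ [:: false].
Proof. by rewrite /encode_nat cats1. Qed.

Lemma check_sound F : check F -> FSTAC_on_fan_stars (gen F).
Proof.
case/andP=> /andP[k0 /eqP En] /andP[/allI cE /andP[/allI cC /andP[/andP[/allI cI /andP[/allI cS1 /allI cS2]] /allI cT]]].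
set n := F 0 0 in En cE cC cI cS1 cS2 cT.
pose N := 3 * F 0 1; rewrite -/N in En; rewrite En in cE cC cI cS1 cS2 cT.
pose io := fun i => inord i : 'I_N.+1.
pose I := @Instance N.+1 [seq (io (F 1 j), io (F 2 j)) | j <- rev (iota 0 (F 0 2))]
  [seq ((io (F 3 j), io (F 4 j)), (io (F 5 j), io (F 6 j))) | j <- rev (iota 0 (F 0 3))].
have inEdges (e : {set 'I_N.+1}) : reflect (exists2 j, j < F 0 2 & e = [set io (F 1 j); io (F 2 j)])
    (e \in edge_set I).
  have -> : (e \in edge_set I) = (e \in [seq edge_of p | p <- edge_list I]) by exact: in_edge_set.
  rewrite /= -map_comp; apply: (iffP mapP) => -[j].
    by rewrite mem_rev mem_iota => lt_j ->; exists j.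
  by move=> lt_j ->; exists j; rewrite // mem_rev mem_iota.
have in_edgesP a b : a < N.+1 -> b < N.+1 -> in_edges F a b -> [set io a; io b] \in edge_set I.
  move=> la lb /hasI[j lt_j Es]; apply/inEdges; exists j => //; apply/eqP.
  by have /andP[? /andP[? _]] := cE _ lt_j; rewrite inord_pair.
have phi_lt a : a < N.+1 -> F 7 a < N.+1 by case/cI/andP.
pose f := fun i : 'I_N.+1 => io (F 7 i).
have finj : injective f.
  move=> i j /(congr1 val) /=; rewrite !inordK ?phi_lt // => Eij; apply/val_inj/eqP.
  by have /andP[_ /allI/(_ j (ltn_ord j))] := cI _ (ltn_ord i); rewrite Eij eqxx.
exists I; split.
- rewrite /gen -/n En /encode_instance !encode_seqE encode_natE.
  congr (_ ++ ((flatten _ ++ _) ++ (flatten _ ++ _))).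
    rewrite -map_comp; apply/eq_in_map => j; rewrite mem_rev mem_iota /= => /cE/andP[? /andP[? _]].
    by rewrite /encode_edge /encode_pair !encode_natE /= !inordK.
  rewrite -map_comp; apply/eq_in_map => j; rewrite mem_rev mem_iota /= => /cC/andP[/andP[/andP[/andP[/andP[/andP[/andP[? ?] ?] ?] _] _] _] _].
  by rewrite /encode_edge /encode_pair !encode_natE /= !inordK.
- split=> [e /inEdges[j lt_j ->]|].
    have /andP[l1 /andP[l2 ne]] := cE _ lt_j; rewrite cards2.
    by case: eqP => // /(congr1 val) /=; rewrite !inordK // => E; rewrite E eqxx in ne.
  exists (F 0 1), f; split=> //; first exact: injF_bij.
  have imf (a b : 'I_N.+1) : f @: [set a; b] = [set f a; f b].
    by rewrite imsetU1 imset_set1.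
  apply/setP => e; apply/inEdges/imsetP => [[j lt_j ->]|[e' /fan_starP[a [b [fab ->]]] ->]].
    have /andP[l1 /andP[l2 _]] := cE _ lt_j.
    have /hasI[a la /hasI[b lb /andP[fab Es]]] := cS1 _ lt_j.
    exists [set io a; io b].
      by apply/fan_starP; exists (io a), (io b); rewrite !inordK.
    by rewrite imf /f !inordK //; apply/eqP; rewrite inord_pair ?phi_lt.
  rewrite imf; apply/inEdges/in_edgesP; try exact: phi_lt.
  by have /allI/(_ b (ltn_ord b))/implyP := cS2 _ (ltn_ord a); apply.
- move=> P; have -> : (P \in conflicts I) = (P \in [seq [set edge_of p.1; edge_of p.2] | p <- conflict_list I]) by exact: in_conflicts.
  rewrite /= -map_comp => /mapP[j]; rewrite mem_rev mem_iota /= => lt_j ->.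
  have /andP[/andP[/andP[/andP[/andP[/andP[/andP[l3 l4] l5] l6] /andP[e1 e2]] nsame] share] _] := cC _ lt_j.
  exists (edge_of (io (F 3 j), io (F 4 j))), (edge_of (io (F 5 j), io (F 6 j))).
  split=> //; try exact: in_edgesP; first by rewrite inord_pair.
  by case/orP: share => [/orP[/orP[]|]|] /eqP E;
   [exists (io (F 3 j)) | exists (io (F 3 j)) | exists (io (F 4 j)) | exists (io (F 4 j))];
   rewrite !inE /= eqxx /= ?orbT /= E eqxx ?orbT.
apply: (proj2 (@FSTAC_parent 'I_(order I) (ord0 : 'I_N.+1) _ _)).
exists (fun v : 'I_N.+1 => io (F 8 v)), (fun v : 'I_N.+1 => F 9 v); split=> [v v0|e g].
  have v0' : v != 0 :> nat by apply: contraNneq v0 => v0; apply/eqP/val_inj.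
  have /implyP/(_ v0')/andP[l8 /andP[l9 e8]] := cT _ (ltn_ord v).
  rewrite inordK //; split=> //.
  by have := in_edgesP v (F 8 v) (ltn_ord v) l8 e8; rewrite /io inord_val.
have -> : ([set e; g] \in conflicts I) = ([set e; g] \in [seq [set edge_of p.1; edge_of p.2] | p <- conflict_list I]) by exact: in_conflicts.
rewrite /= -map_comp => /mapP[j]; rewrite mem_rev mem_iota /= => lt_j Eeg.
have /andP[/andP[/andP[/andP[/andP[/andP[/andP[l3 l4] l5] l6] _] _] _] ntree] := cC _ lt_j.
have treeP a b : a < N.+1 -> b < N.+1 ->
    [set io a; io b] \in parent_tree ord0 (fun v : 'I_N.+1 => io (F 8 v)) -> in_tree F a b.
  move=> la lb /imsetP[v]; rewrite inE => v0.
  have v0' : v != 0 :> nat by apply: contraNneq v0 => v0; apply/eqP/val_inj.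
  have /implyP/(_ v0')/andP[l8 _] := cT _ (ltn_ord v).
  have Ev : v = io v by rewrite /io inord_val.
  move=> /eqP; rewrite {1}Ev inord_pair // /in_tree.
  by case/orP => /andP[/eqP-> /eqP->]; rewrite v0' eqxx ?orbT.
move=> [eT gT]; case/negP: ntree; apply/andP.
by case/eq_pair: Eeg => -[Ee Eg]; subst e g; split; apply: treeP.
Qed.

Lemma size_encode_seq (A : Type) (enc : A -> seq bool) s :
  size s < size (encode_seq enc s).
Proof.
rewrite size_rcons ltnS; elim: s => //= a s IHs.
by rewrite ltnS size_cat (leq_trans IHs) // leq_addl.
Qed.

Lemma rev_nth_map (A B : Type) (x0 : A) (h : A -> B) (s : seq A) :
  [seq h (nth x0 (rev s) j) | j <- rev (iota 0 (size s))] = map h s.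
Proof.
rewrite (map_comp h) map_rev -(size_rev s) map_nth_iota0 //.
by rewrite take_size revK.
Qed.

(** The bound on the entries keeps the unary certificate polynomial. Agreement of [F] and [G] is
    required only on a finite range because a certificate stores finitely many entries. *)
Lemma check_complete w : FSTAC_on_fan_stars w -> exists G : nat -> nat -> nat,
  (forall t j, G t j <= size w) /\
  forall F, (forall t j, t < 10 -> j <= size w -> F t j = G t j) ->
  check F /\ gen F = w.
Proof.
case=> -[n el cl] [Ew [graphE [k [f [k0 bijf Estar]]]] confS fst].
have En : n = (3 * k).+1 by rewrite -(card_ord n) -(bij_eq_card bijf) card_ord.
rewrite /= in graphE Estar confS fst; move: el cl f Ew graphE bijf Estar confS fst.
rewrite /= En => {n En}; set N := 3 * k => el cl f Ew graphE bijf Estar confS fst.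
set I := Instance el cl in Ew graphE Estar confS fst.
have [par [d [Hpar Hav]]] := proj1 (@FSTAC_parent 'I_(order I) (ord0 : 'I_N.+1) _ _) fst.
have [le_n [le_m le_c]] : N.+1 <= size w /\ size el <= size w /\ size cl <= size w.
  rewrite Ew /encode_instance !size_cat size_rcons size_nseq /=.
  have := size_encode_seq (@encode_edge N.+1) el.
  by have := size_encode_seq (encode_pair (@encode_edge N.+1) (@encode_edge N.+1)) cl; lia.
pose io := fun i => inord i : 'I_N.+1.
pose p0 : 'I_N.+1 * 'I_N.+1 := (ord0, ord0).
(* The lists are reversed because [gen] enumerates them backwards. *)
pose p j := nth p0 (rev el) j; pose q j := nth (p0, p0) (rev cl) j.
(* The heights [d] may be arbitrarily large; the rank decreases along parents just as well and is at
   most the number of vertices. *)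
pose rk (v : 'I_N.+1) := #|[set u : 'I_N.+1 | d u < d v]|.
exists (fun t j => if t == 0 then nth 0 [:: N.+1; k; size el; size cl] j
  else if t == 1 then (p j).1 : nat else if t == 2 then (p j).2 : nat
  else if t == 3 then (q j).1.1 : nat else if t == 4 then (q j).1.2 : nat
  else if t == 5 then (q j).2.1 : nat else if t == 6 then (q j).2.2 : nat
  else if t == 7 then f (io j) : nat else if t == 8 then par (io j) : nat
  else rk (io j)).
split=> [t j|F HF].
  do 9?[case: ifP => _; first by [apply: leq_trans (ltnW (ltn_ord _)) le_n |
     case: j => [|[|[|[|j]]]] //=; rewrite ?nth_nil //; move: le_n; rewrite /N; lia]].
  by apply: leq_trans (max_card _) _; rewrite card_ord.
have F00 : F 0 0 = N.+1 by rewrite HF.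
have F01 : F 0 1 = k by rewrite HF //; lia.
have F02 : F 0 2 = size el by rewrite HF //; lia.
have F03 : F 0 3 = size cl by rewrite HF //; lia.
have F1 j : j < size el -> F 1 j = (p j).1 by move=> lt_j; rewrite HF //; lia.
have F2 j : j < size el -> F 2 j = (p j).2 by move=> lt_j; rewrite HF //; lia.
have F3 j : j < size cl -> F 3 j = (q j).1.1 by move=> lt_j; rewrite HF //; lia.
have F4 j : j < size cl -> F 4 j = (q j).1.2 by move=> lt_j; rewrite HF //; lia.
have F5 j : j < size cl -> F 5 j = (q j).2.1 by move=> lt_j; rewrite HF //; lia.
have F6 j : j < size cl -> F 6 j = (q j).2.2 by move=> lt_j; rewrite HF //; lia.
have F7 j : j < N.+1 -> F 7 j = f (io j) by move=> lt_j; rewrite HF //; lia.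
have F8 j : j < N.+1 -> F 8 j = par (io j) by move=> lt_j; rewrite HF //; lia.
have F9 j : j < N.+1 -> F 9 j = rk (io j) by move=> lt_j; rewrite HF //; lia.
have sameE (a b a' b' : 'I_N.+1) : same a b a' b' = ([set a; b] == [set a'; b']).
  by rewrite -[in RHS](inord_val a) -[in RHS](inord_val b) -[in RHS](inord_val a')
    -[in RHS](inord_val b') inord_pair.
have pP j : j < size el -> edge_of (p j) \in edge_set I.
  move=> lt_j; have -> : (edge_of (p j) \in edge_set I) = (edge_of (p j) \in map (@edge_of _) el) by exact: in_edge_set.
  by apply: map_f; rewrite -mem_rev mem_nth ?size_rev.
have in_edgesP (a b : 'I_N.+1) : [set a; b] \in edge_set I -> in_edges F a b.
  have -> : ([set a; b] \in edge_set I) = ([set a; b] \in map (@edge_of _) el) by exact: in_edge_set.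
  case/mapP => r r_el Er; apply/hasI; rewrite F02.
  have lt_r : index r (rev el) < size el by rewrite -(size_rev el) index_mem mem_rev.
  exists (index r (rev el)) => //.
  by rewrite F1 // F2 // /p nth_index ?mem_rev // sameE Er.
have qP j : j < size cl -> [/\ edge_of (q j).1 \in edge_set I, edge_of (q j).2 \in edge_set I,
     edge_of (q j).1 != edge_of (q j).2, adjacent_edges (edge_of (q j).1) (edge_of (q j).2)
   & [set edge_of (q j).1; edge_of (q j).2] \in conflicts I].
  move=> lt_j; have inC : [set edge_of (q j).1; edge_of (q j).2] \in conflicts I.
    have -> : ([set edge_of (q j).1; edge_of (q j).2] \in conflicts I) =
      ([set edge_of (q j).1; edge_of (q j).2] \in [seq [set edge_of r.1; edge_of r.2] | r <- cl]) by exact: in_conflicts.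
    by apply: (map_f (fun r => [set edge_of r.1; edge_of r.2])); rewrite -mem_rev mem_nth ?size_rev.
  have [e [g [/eq_pair E eE gE ne [x xeg]]]] := confS _ inC.
  case: E => -[E1 E2]; split=> //; rewrite ?E1 ?E2 //; first by exists x.
    by rewrite eq_sym.
  by exists x; rewrite setIC.
have io_val (a : 'I_N.+1) : io a = a by rewrite /io inord_val.
split.
  rewrite /check F00 F01 k0 eqxx /=; apply/and4P; split.
  - rewrite /check_edges F02 F00; apply/allI => j lt_j; rewrite F1 // F2 // !ltn_ord /=.
    have := graphE _ (pP j lt_j); rewrite /edge_of cards2.
    by case: eqP => // ne _; apply/eqP => /val_inj.
  - rewrite /check_conflicts F03 F00; apply/allI => j lt_j.
    rewrite F3 // F4 // F5 // F6 // !ltn_ord /= !in_edgesP; try by case: (qP j lt_j).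
    have [e1 e2 ne [x]] := qP j lt_j; rewrite inE /= => xs inC.
    apply/andP; split; first (apply/andP; split).
    + by rewrite sameE.
    + move: xs; rewrite !inE => /andP[/orP[]/eqP-> /orP[]/eqP->]; by rewrite eqxx ?orbT.
    apply/andP=> -[t1 t2].
    have treeP (a b : 'I_N.+1) : in_tree F a b -> [set a; b] \in parent_tree (ord0 : 'I_N.+1) par.
      by case/orP=> /andP[a0]; rewrite F8 // io_val => /eqP /val_inj <-; apply/imsetP;
        [exists a | exists b; rewrite 1?setUC] => //; rewrite inE; apply: contraNneq a0 => ->.
    by apply: (Hav _ _ inC); split; apply: treeP.
  - rewrite /check_star F00 F02; apply/and3P; split.
    + apply/allI => i lt_i; rewrite F7 // ltn_ord andTb; apply/allI => j lt_j; rewrite F7 //.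
      apply/implyP => /eqP /val_inj /(bij_inj bijf) /(congr1 val) /=.
      by rewrite !inordK // => ->.
    + apply/allI => j lt_j; have := pP j lt_j; rewrite Estar => /imsetP[e /fan_starP[a [b [fab ->]]] Ep].
      apply/hasI; exists a => //; apply/hasI; exists b => //; rewrite fab F1 // F2 // !F7 //.
      rewrite !io_val sameE; apply/eqP; rewrite -[LHS]/(edge_of (p j)) Ep.
      by rewrite imsetU1 imset_set1.
    apply/allI => a la; apply/allI => b lb; apply/implyP => fab.
    rewrite !F7 //; apply: in_edgesP; rewrite Estar; apply/imsetP.
    exists [set io a; io b]; last by rewrite imsetU1 imset_set1.
    by apply/fan_starP; exists (io a), (io b); rewrite !inordK.
  rewrite /check_tree F00; apply/allI => i lt_i; apply/implyP => i0.
  have i0' : io i != ord0 by apply: contraNneq i0 => /(congr1 val) /=; rewrite inordK // => ->.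
  have [ioE lt_d] := Hpar _ i0'.
  rewrite F8 // ltn_ord /= !F9 // io_val; apply/andP; split.
    apply: proper_card; apply/properP; split.
      by apply/subsetP => u; rewrite !inE => lt_u; exact: ltn_trans lt_u lt_d.
    by exists (par (io i)); rewrite !inE ?ltnn.
  by rewrite -[i in in_edges F i](inordK lt_i); apply: in_edgesP.
rewrite /gen F00 F02 F03 Ew /encode_instance !encode_seqE encode_natE.
congr (_ ++ ((flatten _ ++ _) ++ (flatten _ ++ _))).
  rewrite -(rev_nth_map p0); apply/eq_in_map => j; rewrite mem_rev mem_iota /= => lt_j.
  by rewrite /encode_edge /encode_pair !encode_natE F1 // F2.
rewrite -(rev_nth_map (p0, p0)); apply/eq_in_map => j; rewrite mem_rev mem_iota /= => lt_j.
by rewrite /encode_pair /encode_edge /encode_pair !encode_natE F3 // F4 // F5 // F6.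
Qed.

(** The ten arrays are interleaved in a single list of numbers, entry [j] of array [t] standing at
    place [t + 10 * j]. *)
Lemma bool_expr_check : bool_expr [:: fst; snd] (fun p : seq bool * seq bool =>
  (p.1 == gen (fun t j => block p.2 (t + 10 * j))) && check (fun t j => block p.2 (t + 10 * j))).
Proof.
have HX : str_expr [:: fst; snd] (fun p : seq bool * seq bool => p.1) by exists (Var 0).
have HY : str_expr [:: fst; snd] (fun p : seq bool * seq bool => p.2) by exists (Var 1).
rewrite /check /gen /check_edges /check_conflicts /check_star /check_tree
  /in_edges /in_tree /same /fs_edge.
by closure.
Qed.

Theorem FSTAC_in_NP : NP FSTAC_on_fan_stars.
Proof.
have [e He] := bool_expr_check.
pose V x y := eval [:: x; y] e != [::].
have VE x y : V x y = (x == gen (fun t j => block y (t + 10 * j))) &&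
    check (fun t j => block y (t + 10 * j)).
  by rewrite /V -(He (x, y)) /= lt0n size_eq0.
(* A certificate consists of [10 * n.+1] numbers, each at most [n], written in unary with a
   separator. *)
have [p Hp] : poly_bounded (fun n => 10 * n.+1 * n.+1).
  have HS := poly_bounded_add (poly_bounded_const 1) poly_bounded_id.
  exact: poly_bounded_mul (poly_bounded_mul (poly_bounded_const 10) HS) HS.
exists V, p; split; first exact: polytime_rel_eval.
move=> x; split=> [Lx|[y [_]]]; last first.
  by rewrite VE => /andP[/eqP -> /check_sound].
have [G [le_G HG]] := check_complete Lx.
pose l := [seq G (i %% 10) (i %/ 10) | i <- iota 0 (10 * (size x).+1)].
exists (flatten (map encode_nat l)); split.
  apply: leq_trans (Hp _); rewrite size_flatten /shape -!map_comp.
  rewrite -{2}(size_iota 0 (10 * (size x).+1)); elim: (iota _ _) => //= i r IHr.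
  by rewrite mulSn leq_add // size_rcons size_nseq ltnS.
have [chk gen_x] : check (fun t j => block (flatten (map encode_nat l)) (t + 10 * j)) /\
    gen (fun t j => block (flatten (map encode_nat l)) (t + 10 * j)) = x.
  apply: HG => t j lt_t le_j; rewrite block_encode (nth_map 0) ?size_iota; last by lia.
  rewrite nth_iota ?add0n; last by lia.
  by rewrite [t + _]addnC [10 * j]mulnC modnMDl modn_small // divnMDl // divn_small // addn0.
by rewrite VE gen_x eqxx chk.
Qed.

(** * Selecting a vertex in every triple *)

Definition prefix_code (A : Type) (enc : A -> seq bool) : Prop :=
  forall a b u v, enc a ++ u = enc b ++ v -> a = b /\ u = v.

Lemma prefix_code_nat : prefix_code encode_nat.
Proof.
move=> a b u v; rewrite /encode_nat -!cats1 -!catA.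
elim: a b => [|a IHa] [|b] //= [].
  by move=> ->.
by case/IHa=> -> ->.
Qed.

Lemma prefix_code_pair (A B : Type) (encA : A -> seq bool) (encB : B -> seq bool) :
  prefix_code encA -> prefix_code encB -> prefix_code (encode_pair encA encB).
Proof.
move=> HA HB [a b] [a' b'] u v; rewrite /encode_pair -!catA.
by case/HA=> /= -> /HB[/= -> ->].
Qed.

Lemma prefix_code_seq (A : Type) (enc : A -> seq bool) :
  prefix_code enc -> prefix_code (encode_seq enc).
Proof.
move=> H s s' u v; rewrite !encode_seqE -!catA.
elim: s s' => [|a s IHs] [|a' s'] //=; first by case=> ->.
by case; rewrite -!catA => /H[-> /IHs[-> ->]].
Qed.

Lemma prefix_code_edge n : prefix_code (@encode_edge n).
Proof.
have H : prefix_code (fun i : 'I_n => encode_nat i).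
  by move=> a b u v /prefix_code_nat[/val_inj-> ->].
exact: prefix_code_pair.
Qed.

(** The language only asks for some instance with the given code; injectivity identifies it with the
    one that the reduction built. *)
Lemma encode_instance_inj : injective encode_instance.
Proof.
move=> [n el cl] [n' el' cl']; rewrite /encode_instance /= => /prefix_code_nat[En].
case: n' / En el' cl' => el' cl' /(prefix_code_seq (@prefix_code_edge n))[<- E].
have H := prefix_code_seq (prefix_code_pair (@prefix_code_edge n) (@prefix_code_edge n)).
by have [<- _] := H cl cl' [::] [::] (congr1 (cat^~ [::]) E).
Qed.

Section TripleInstance.
Variables (k : nat) (C : nat -> nat -> bool).
Hypothesis k0 : 0 < k.
Let V := 'I_(3 * k).+1.
Let io (i : nat) : V := inord i.

(* Positions [i < 3 * k] of the path correspond to the vertices [i + 1]. *)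
Definition triple_edges : seq (V * V) :=
  [seq (ord0, inord i.+1) | i <- rev (iota 0 (3 * k))] ++
  flatten [seq (if i %% 3 != 0 then [:: (inord i, inord i.+1)] else [::])
             | i <- rev (iota 0 (3 * k))].

Definition triple_conflicts : seq ((V * V) * (V * V)) :=
  flatten [seq flatten [seq (if (i != j) && C i j
      then [:: ((ord0, inord i.+1), (ord0, inord j.+1))] else [::])
    | j <- rev (iota 0 (3 * k))] | i <- rev (iota 0 (3 * k))].

Definition triple_instance : instance :=
  @Instance (3 * k).+1 triple_edges triple_conflicts.

Lemma triple_edge_set : edge_set triple_instance = fan_star k.
Proof.
apply/setP => e; rewrite in_edge_set /= /triple_edges map_cat mem_cat.
apply/orP/fan_starP => [[/mapP[p /mapP[i]]|/mapP[p /flattenP[s /mapP[i]]]]|].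
- rewrite mem_rev mem_iota => /andP[_ lt_i] -> ->; exists ord0, (inord i.+1).
  by split=> //; rewrite /fs_edge inordK.
- rewrite mem_rev mem_iota => /andP[_ lt_i] ->; case: ifP => // i3.
  rewrite inE => /eqP -> ->; exists (inord i), (inord i.+1); split=> //.
  by rewrite /fs_edge !inordK ?ltnS ?(ltnW lt_i) // leqnn eqxx i3 orbT.
move=> [i [j [/andP[lt_ij /orP fs] ->]]]; have lt_j := ltn_ord j.
case: fs => [/eqP i0|/andP[/eqP Ej i3]]; [left|right]; apply/mapP.
  exists (ord0, j); last by congr [set _; _]; exact: val_inj.
  apply/mapP; exists j.-1; first by rewrite mem_rev mem_iota; lia.
  by congr pair; apply: val_inj; rewrite /= inordK; lia.
exists (i, j) => //; apply/flattenP; exists [:: (i, j)]; rewrite ?inE //.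
apply/mapP; exists (i : nat); first by rewrite mem_rev mem_iota; lia.
by rewrite i3 inord_val -Ej inord_val.
Qed.

Lemma triple_conflictsP P : reflect
  (exists i j, [/\ i < 3 * k, j < 3 * k, i != j, C i j
     & P = [set [set ord0; io i.+1]; [set ord0; io j.+1]]])
  (P \in conflicts triple_instance).
Proof.
have -> : (P \in conflicts triple_instance) = (P \in [seq [set edge_of p.1; edge_of p.2] | p <- triple_conflicts]).
  exact: in_conflicts.
apply: (iffP mapP) => [[p /flattenP[s /mapP[i]]]|[i [j [li lj ne Cij ->]]]].
  rewrite mem_rev mem_iota => /andP[_ li] -> /flattenP[s' /mapP[j]].
  rewrite mem_rev mem_iota => /andP[_ lj] ->; case: ifP => // /andP[ne Cij].
  by rewrite inE => /eqP -> ->; exists i, j.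
exists ((ord0, io i.+1), (ord0, io j.+1)) => //.
apply/flattenP; eexists; first by apply/mapP; exists i; rewrite // mem_rev mem_iota.
apply/flattenP; eexists; first by apply/mapP; exists j; rewrite // mem_rev mem_iota.
by rewrite ne Cij inE.
Qed.

Lemma triple_fan_star : is_fan_star (edge_set triple_instance).
Proof.
rewrite triple_edge_set; exists k, id; split=> //; first by exists id.
have im_id (e : {set V}) : id @: e = e by exact: imset_id.
by apply/setP => e; apply/idP/imsetP => [eE|[e' eE ->]]; [exists e | ]; rewrite ?im_id.
Qed.

Lemma triple_is_graph : is_graph (edge_set triple_instance).
Proof.
move=> e; rewrite triple_edge_set => /fan_starP[i [j [/andP[lt_ij _] ->]]].
by rewrite cards2; case: eqP lt_ij => // ->; rewrite ltnn.
Qed.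

Lemma hub_edge i : i < 3 * k -> [set ord0; io i.+1] \in fan_star k.
Proof.
move=> lt_i; apply/fan_starP; exists ord0, (io i.+1).
by rewrite /fs_edge inordK.
Qed.

Lemma io_inj i j : i < (3 * k).+1 -> j < (3 * k).+1 -> io i = io j -> i = j.
Proof. by move=> li lj /(congr1 val); rewrite /= !inordK. Qed.

Lemma io0 i : i < 3 * k -> (ord0 : V) <> io i.+1.
Proof. by move=> lt_i /(congr1 val); rewrite /= inordK. Qed.

Lemma triple_conflict_set :
  conflict_set (edge_set triple_instance) (conflicts triple_instance).
Proof.
move=> P /triple_conflictsP[i [j [li lj ne Cij ->]]].
exists [set ord0; io i.+1], [set ord0; io j.+1]; rewrite triple_edge_set.
split=> //; try exact: hub_edge; last by exists ord0; rewrite !inE eqxx.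
apply: contra ne => /eqP/eq_pair[[_ /io_inj E]|[/io0]]; last by case.
by apply/eqP; have /succn_inj := E li lj.
Qed.

(** Quantifying over [i] and [j] in both orders accounts for unordered conflicts without assuming
    [C] symmetric. *)
Definition selection (X : nat -> bool) : Prop :=
  (forall g, g < k -> [|| X (3 * g), X (3 * g).+1 | X (3 * g).+2]) /\
  (forall i j, i < 3 * k -> j < 3 * k -> i != j -> X i -> X j -> ~~ C i j).

Lemma FSTAC_selection :
  FSTAC (edge_set triple_instance) (conflicts triple_instance) ->
  exists X, selection X.
Proof.
rewrite triple_edge_set => -[T [[/subsetP subT conn _] av]].
exists (fun i => [set ord0; io i.+1] \in T); split=> [g lt_g|i j li lj ne Ti Tj].
  apply: contraT => /norP[n0 /norP[n1 n2]].
  (* The vertices of triple [g]. Besides its three spokes, assumed absent from [T], every path edge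
     that would leave it has been deleted, so this set is closed and cannot reach the hub. *)
  pose A := [pred v : V | (3 * g < v) && (v <= (3 * g).+3)].
  have clA : closed (adj T) A.
    apply: intro_closed; first exact: sym_connect_sym (@adj_sym _ T).
    move=> x y /andP[_ xyT] /andP[lx lx'].
    have Tn (v : V) : 3 * g < v -> v <= (3 * g).+3 -> [set ord0; v] \notin T.
      move=> lv lv'; have -> : v = io v by rewrite /io inord_val.
      have : (v : nat) \in [:: (3 * g).+1; (3 * g).+2; (3 * g).+3] by rewrite !inE; lia.
      by rewrite !inE => /or3P[]/eqP->.
    have xn0 : x != ord0 by apply: contraTneq lx => ->.
    have yn0 : y != ord0 by apply: contraTneq xyT => ->; rewrite setUC Tn.
    have /fan_starP[i [j [fs]]] := subT _ xyT.
    have nat0 (v : V) : v != ord0 -> v != 0 :> nat by apply: contraNneq => v0; apply/eqP/val_inj.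
    move: (nat0 _ xn0) (nat0 _ yn0) => {}xn0 {}yn0.
    case/eq_pair => -[Ei Ej]; move: fs; rewrite -Ei -Ej /fs_edge inE /=; lia.
  have := closed_connect clA (conn (io (3 * g).+1) ord0).
  by rewrite !inE /= inordK; lia.
apply/negP => Cij; apply: (av [set ord0; io i.+1] [set ord0; io j.+1]); last by [].
by apply/triple_conflictsP; exists i, j.
Qed.

Lemma selection_FSTAC X : selection X ->
  FSTAC (edge_set triple_instance) (conflicts triple_instance).
Proof.
move=> [hit free]; apply: (proj2 (@FSTAC_parent V ord0 _ _)).
(* The first selected position in the triple of [p], the only one of the triple to be joined to the
   hub. *)
pose x p := let g := 3 * (p %/ 3) in
  if X g then g else if X g.+1 then g.+1 else g.+2.
(* Position [p] is vertex [p.+1], so [p.+2] and [p] are its right and left neighbours on the path: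
   every vertex steps towards [x p], and [x p] steps to the hub. *)
pose par (v : V) : V := let p := v.-1 in
  io (if p == x p then 0 else if p < x p then p.+2 else p).
(* One more than the distance from [p] to [x p] on the path; of the two truncated differences at
   least one vanishes. *)
pose d (v : V) := if v == 0 :> nat then 0 else
  let p := v.-1 in ((p - x p) + (x p - p)).+1.
have xX p : p < 3 * k -> X (x p).
  move=> lt_p; have /hit : p %/ 3 < k by rewrite ltn_divLR // mulnC.
  by rewrite /x; case: ifP => // _; case: ifP.
have xr p : (x p) %/ 3 = p %/ 3 by rewrite /x; case: ifP => _; [|case: ifP => _]; lia.
exists par, d; rewrite triple_edge_set; split=> [v v0|e f].
  have {}v0 : v != 0 :> nat by apply: contraNneq v0 => v0; apply/eqP/val_inj.
  have lt_v := ltn_ord v.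
  have lt_par : (if v.-1 == x v.-1 then 0 else if v.-1 < x v.-1 then v.-1.+2 else v.-1) < (3 * k).+1.
    by have := xr v.-1; case: eqP => // _; case: ifP; lia.
  have vpar : (par v : nat) = if v.-1 == x v.-1 then 0 else if v.-1 < x v.-1 then v.-1.+2 else v.-1.
    by rewrite /par inordK.
  have := xr v.-1; split.
    case: (ltngtP v.-1 (x v.-1)) vpar => [lt_x|lt_x|Ex] Ep.
    - by apply/fan_starP; exists v, (par v); rewrite /fs_edge Ep; split=> //; lia.
    - by apply/fan_starP; exists (par v), v; rewrite setUC /fs_edge Ep; split=> //; lia.
    by apply/fan_starP; exists (par v), v; rewrite setUC /fs_edge Ep; split=> //; lia.
  rewrite /d vpar (negPf v0); case: (ltngtP v.-1 (x v.-1)) => // lt_x.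
    have Ex : x v.-1.+1 = x v.-1 by rewrite /x (_ : v.-1.+1 %/ 3 = v.-1 %/ 3) //; lia.
    by rewrite /= Ex; lia.
  have Ex : x v.-1.-1 = x v.-1 by rewrite /x (_ : v.-1.-1 %/ 3 = v.-1 %/ 3) //; lia.
  by case: eqP => _; rewrite ?Ex; lia.
move=> /triple_conflictsP[i [j [li lj ne Cij Eef]]] [eT fT].
have TX p : p < 3 * k -> [set ord0; io p.+1] \in parent_tree (ord0 : V) par -> X p.
  move=> lt_p /imsetP[v]; rewrite inE => v0 /eq_pair[[v0' _]|[par0 Ev]].
    by rewrite -v0' eqxx in v0.
  have Evp : v = p.+1 :> nat by rewrite -Ev /io inordK.
  have := congr1 val par0; rewrite /= /par Evp /=.
  case: eqP => [->|nex]; first by rewrite xX.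
  by have := xr p; case: ifP => lt_x xp; rewrite inordK; lia.
have Xi : X i /\ X j.
  by case/eq_pair: Eef => -[Ee Ef]; subst e f; split; apply: TX.
by case: Xi => Xi Xj; have := free i j li lj ne Xi Xj; rewrite Cij.
Qed.

Lemma triple_instanceP :
  FSTAC_on_fan_stars (encode_instance triple_instance) <-> exists X, selection X.
Proof.
split=> [[I [/encode_instance_inj <- _ _]]|[X HX]]; first exact: FSTAC_selection.
exists triple_instance; split=> //.
- by split; [exact: triple_is_graph | exact: triple_fan_star].
- exact: triple_conflict_set.
exact: selection_FSTAC HX.
Qed.
End TripleInstance.

(** * Binary constraints *)

Section Csp.
Variables (N D : nat) (B : nat -> nat -> nat -> nat -> bool).
Hypothesis D0 : 0 < D.

Definition csp_solution (s : nat -> nat) : Prop :=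
  (forall u, u < N -> s u < D) /\
  (forall u u', u < N -> u' < N -> u != u' -> ~~ B u (s u) u' (s u')).

(* The choice of a value [d < D] for the node [u] is made by the chain of the
   triples [u * D + d], d < D.  Their middle vertices stand for the values; the
   last vertex of one triple conflicts with the first vertex of the next, and
   the two ends of the chain are extra copies of the values [0] and [D - 1]. *)
Definition node (p : nat) : nat := p %/ 3 %/ D.
Definition value (p : nat) : nat := p %/ 3 %% D.
Definition labelled (p : nat) : bool :=
  [|| p %% 3 == 1, (p %% 3 == 0) && (value p == 0)
    | (p %% 3 == 2) && ((value p).+1 == D)].
Definition csp_conflict (p q : nat) : bool :=
  ((p %% 3 == 2) && (q == p.+1) && ((p %/ 3).+1 %% D != 0)) ||
  (labelled p && labelled q && B (node p) (value p) (node q) (value q)).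

(** If no labelled vertex of a chain were chosen, the first triple would have to choose its last
    vertex; each such choice forbids the first vertex of the next triple and thus forces its last
    one, up to the last vertex of the chain, which is labelled. *)
Lemma selection_csp X : selection (N * D) csp_conflict X ->
  exists s, csp_solution s.
Proof.
move=> [hit free].
pose good u p := [&& node p == u, labelled p & X p].
have ex_good u : u < N -> has (good u) (iota 0 (3 * (N * D))).
  move=> lt_u; apply: contraT => none.
  have lt_pos d r : d < D -> r < 3 -> 3 * (u * D + d) + r < 3 * (N * D).
    move=> lt_d lt_r; have : u * D + d < N * D.
      by apply: (@leq_trans (u.+1 * D)); rewrite ?leq_mul2r ?lt_u ?orbT // mulSn addnC ltn_add2r.
    by lia.
  have div3 d r : r < 3 -> (3 * (u * D + d) + r) %/ 3 = u * D + d by lia.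
  have mod3 d r : r < 3 -> (3 * (u * D + d) + r) %% 3 = r by lia.
  have nodeE d r : d < D -> r < 3 -> node (3 * (u * D + d) + r) = u.
    by move=> lt_d lt_r; rewrite /node div3 // divnMDl // divn_small // addn0.
  have valueE d r : d < D -> r < 3 -> value (3 * (u * D + d) + r) = d.
    by move=> lt_d lt_r; rewrite /value div3 // modnMDl modn_small.
  have noX d r : d < D -> r < 3 -> labelled (3 * (u * D + d) + r) -> X (3 * (u * D + d) + r) = false.
    move=> lt_d lt_r lab; apply/negP => Xp; case/hasP: none.
    exists (3 * (u * D + d) + r); first by rewrite mem_iota lt_pos.
    by rewrite /good nodeE // eqxx lab.
  have hit' d : d < D -> [|| X (3 * (u * D + d) + 0), X (3 * (u * D + d) + 1) | X (3 * (u * D + d) + 2)].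
    move=> lt_d; rewrite addn0 addn1 addn2; apply: hit.
    by have := lt_pos d 0 lt_d isT; lia.
  have mid d : d < D -> X (3 * (u * D + d) + 1) = false.
    by move=> lt_d; apply: noX => //; rewrite /labelled mod3.
  have all2 d : d < D -> X (3 * (u * D + d) + 2).
    elim: d => [|d IHd] lt_d.
      by have := hit' _ lt_d; rewrite mid // noX // /labelled mod3 // valueE.
    have X2 := IHd (ltnW lt_d).
    have := hit' _ lt_d; rewrite mid // orFb; case/orP => // X0.
    have ne : 3 * (u * D + d) + 2 != 3 * (u * D + d.+1) + 0 by lia.
    have := free _ _ (lt_pos d 2 (ltnW lt_d) isT) (lt_pos d.+1 0 lt_d isT) ne X2 X0.
    rewrite /csp_conflict mod3 // div3 // (_ : 3 * (u * D + d.+1) + 0 == (3 * (u * D + d) + 2).+1); last by lia.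
    by rewrite -addnS modnMDl modn_small.
  have lt_D : D.-1 < D by lia.
  have lab : labelled (3 * (u * D + D.-1) + 2).
    by rewrite /labelled mod3 // valueE // prednK // !eqxx.
  by have := all2 _ lt_D; rewrite noX.
(* Several labelled vertices of a chain may be chosen; the first one decides the value. *)
pose pos u := nth 0 (iota 0 (3 * (N * D))) (find (good u) (iota 0 (3 * (N * D)))).
have pos_good u : u < N -> good u (pos u) by move=> lt_u; apply: nth_find; exact: ex_good.
have pos_lt u : u < N -> pos u < 3 * (N * D).
  move=> lt_u; have : pos u \in iota 0 (3 * (N * D)).
    by rewrite mem_nth // -has_find ex_good.
  by rewrite mem_iota.
exists (fun u => value (pos u)); split=> [u _|u u' lt_u lt_u' ne]; first by rewrite ltn_mod.
have /and3P[/eqP nu lu Xu] := pos_good u lt_u.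
have /and3P[/eqP nu' lu' Xu'] := pos_good u' lt_u'.
have nepos : pos u != pos u' by apply: contraNneq ne => E; rewrite -nu -nu' E.
have := free _ _ (pos_lt u lt_u) (pos_lt u' lt_u') nepos Xu Xu'.
by rewrite /csp_conflict lu lu' nu nu'; case/norP.
Qed.

Lemma csp_selection s : csp_solution s ->
  exists X, selection (N * D) csp_conflict X.
Proof.
move=> [lt_s free].
(* Triples before the chosen value take their last vertex, the triple of the value its middle one,
   later triples their first one; so a last vertex is never followed by a first vertex. *)
pose X p := [|| (p %% 3 == 2) && (value p < s (node p)),
  (p %% 3 == 1) && (value p == s (node p)) | (p %% 3 == 0) && (s (node p) < value p)].
have node_lt p : p < 3 * (N * D) -> node p < N.
  by move=> lt_p; rewrite /node !ltn_divLR // mulnC.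
exists X; split=> [g lt_g|p q lt_p lt_q ne Xp Xq].
  have [d0 d1 d2] : [/\ (3 * g) %/ 3 = g, (3 * g).+1 %/ 3 = g & (3 * g).+2 %/ 3 = g] by split; lia.
  have [m0 m1 m2] : [/\ (3 * g) %% 3 = 0, (3 * g).+1 %% 3 = 1 & (3 * g).+2 %% 3 = 2] by split; lia.
  rewrite /X /value /node d0 d1 d2 m0 m1 m2 /= !orbF.
  by case: (ltngtP (g %% D) (s (g %/ D))) => //; rewrite ?orbT.
apply/norP; split.
  apply/negP => /andP[/andP[/eqP p2 /eqP Eq] pD].
  have q0 : q %% 3 = 0 by lia.
  have q3 : q %/ 3 = (p %/ 3).+1 by lia.
  move: Xp Xq; rewrite /X p2 q0 /= !orbF /value /node q3.
  have [E1 E2] : ((p %/ 3).+1 %/ D = p %/ 3 %/ D) /\ ((p %/ 3).+1 %% D = (p %/ 3 %% D).+1).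
    have := divn_eq (p %/ 3) D; have := ltn_pmod (p %/ 3) D0; move: pD.
    move: (p %/ 3 %/ D) (p %/ 3 %% D) => a b pD; rewrite leq_eqVlt => /orP[/eqP Eb|lt_b] Ep.
      by move: pD; rewrite Ep -addnS Eb modnMDl modnn.
    by rewrite Ep -addnS divnMDl // divn_small // addn0 modnMDl modn_small.
  by rewrite E1 E2 => lt1 lt2; move: (leq_trans lt1 lt2); rewrite ltnn.
apply/negP => /andP[/andP[lp lq] Bpq].
(* The labelled ends of the chain are not chosen: this would need [s u < 0] or a value [s u] beyond
   [D.-1]. Hence only the middle vertex of the chosen value counts. *)
have val r : r < 3 * (N * D) -> X r -> labelled r -> r %% 3 = 1 /\ value r = s (node r).
  move=> lt_r; rewrite /X /labelled; have : r %% 3 < 3 by rewrite ltn_mod.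
  have := lt_s _ (node_lt _ lt_r); case: (r %% 3) => [|[|[|m]]] //= lt_sr _.
  - by rewrite ?orbF => lt_v /eqP E; rewrite E in lt_v.
  - by rewrite ?orbF => /eqP.
  by rewrite ?orbF => lt_v /eqP E; move: lt_v lt_sr; rewrite -E ltnS => le1 le2; move: (leq_trans le1 le2); rewrite ltnn.
have [p1 vp] := val p lt_p Xp lp; have [q1 vq] := val q lt_q Xq lq.
have [Enode|nenode] := eqVneq (node p) (node q); last first.
  by have := free _ _ (node_lt _ lt_p) (node_lt _ lt_q) nenode; rewrite -vp -vq Bpq.
case/negP: ne; apply/eqP; rewrite (divn_eq p 3) (divn_eq q 3) p1 q1; congr (_ * 3 + 1).
rewrite (divn_eq (p %/ 3) D) (divn_eq (q %/ 3) D) -/(node p) -/(node q).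
by rewrite -/(value p) -/(value q) vp vq Enode.
Qed.
End Csp.

(** * Computation tableaux *)

Lemma act_stay (W : finType) (tp : tape W) : act (thead tp, MoveStay) tp = tp.
Proof. by case: tp. Qed.

Definition head_move (m : move) (h : nat) : nat :=
  match m with MoveLeft => h.-1 | MoveStay => h | MoveRight => h.+1 end.

(* The content of the cell [p] when the head is at position [h]. *)
Definition cell (W : finType) (tp : tape W) (h p : nat) : tsym W :=
  if p < h then nth blank (tleft tp) (h - p.+1)
  else nth blank (thead tp :: tright tp) (p - h).

Lemma cell_head (W : finType) (tp : tape W) h : cell tp h h = thead tp.
Proof. by rewrite /cell ltnn subnn. Qed.

(** With absolute positions a move changes no cell besides the one written. The assumption [0 < h]
    prevents the truncated [h.-1] from staying at 0 while the tape moves. *)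
Lemma cell_act (W : finType) (tp : tape W) (s : tsym W) m h p : 0 < h ->
  cell (act (s, m) tp) (head_move m h) p = if p == h then s else cell tp h p.
Proof.
case: h => // h _; rewrite /cell.
case: m => /=; case: (ltngtP p h.+1) => [lt_p|lt_p|->] //=.
- case: ltnP => [lt_ph|le_hp]; first by rewrite nth_behead; congr nth; lia.
  have -> : p = h by lia.
  by rewrite !subnn /= ?subnn; case: (tleft tp).
- rewrite ltnNge (ltnW (ltnW lt_p)) /=.
  have -> : p - h = (p - h.+2).+2 by lia.
  by have -> : p - h.+1 = (p - h.+2).+1 by lia.
- by rewrite ltnNge leqnSn /= subSnn.
- by have -> : p - h.+1 = (p - h.+2).+1 by lia.
- by rewrite subnn.
- rewrite ltnS (ltnW lt_p).
  by have -> : h.+2 - p.+1 = (h.+1 - p.+1).+1 by lia.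
- rewrite ltnNge lt_p /=.
  have -> : p - h.+1 = (p - h.+2).+1 by lia.
  case: (p - h.+2) => [|k] /=; first by rewrite nth0.
  by rewrite nth_behead.
by rewrite ltnSn subnn.
Qed.

(* [None], [Some true] and [Some false] say that the head is at, to the right
   of, and to the left of the position. *)
Definition dir (h p : nat) : option bool := if h == p then None else Some (p < h).

Definition dir_is (c : option bool) (h p : nat) : bool :=
  match c with None => h == p | Some true => p < h | Some false => h < p end.

Lemma dir_isE c h p : dir_is c h p = (c == dir h p).
Proof. by rewrite /dir /dir_is; case: c => [[]|]; case: (ltngtP p h). Qed.

(** Along a row these pairs allow a block of [Some true], then at most one [None], then a block of
    [Some false]. *)
Definition dir_row (a b : option bool) : bool :=
  if a == Some true then b != Some false else b == Some false.

Definition dir_step (m : move) (a b : option bool) : bool :=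
  match m with
  | MoveStay => b == a
  | MoveRight => if a == Some false then b != Some true else b == Some true
  | MoveLeft => if a == Some true then b != Some false else b == Some false
  end.

Lemma dir_rowP h p : dir_row (dir h p) (dir h p.+1).
Proof. by rewrite /dir /dir_row; case: (ltngtP h p); case: (ltngtP h p.+1) => //; lia. Qed.

Lemma dir_stepP m h p : 0 < h -> dir_step m (dir h p) (dir (head_move m h) p).
Proof.
case: h => // h _; rewrite /dir /dir_step; case: m => //=.
  by case: (ltngtP h.+1 p); case: (ltngtP h p) => //; lia.
by case: (ltngtP h.+1 p); case: (ltngtP h.+2 p) => //; lia.
Qed.

(** After a move, [dir_step] settles the cells on one side and leaves two options on the other. The
    row shape then places the head right next to the settled block and propagates away from it; the
    bounds on [h] keep the new position inside the row. *)
Lemma dir_step_det m h w (g : nat -> option bool) : 0 < h -> h.+1 < w ->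
  (forall p, p < w -> dir_step m (dir h p) (g p)) ->
  (forall p, p.+1 < w -> dir_row (g p) (g p.+1)) ->
  forall p, p < w -> g p = dir (head_move m h) p.
Proof.
move=> h0 lt_h step row p lt_p.
case: m step => step; [|by have /eqP := step p lt_p|]; last first.
  have Hr q : q <= h -> g q = Some true.
    move=> le_q; have := step q (leq_ltn_trans le_q (ltnW lt_h)).
    by rewrite /= /dir; case: (ltngtP h q) le_q => // _ _ /eqP.
  have Hn : g h.+1 = None.
    have := row h lt_h; rewrite Hr // /dir_row /=.
    have := step h.+1 lt_h; rewrite /= /dir; case: (ltngtP h h.+1); try lia.
    by case: (g h.+1) => [[]|].
  have Hl n : h.+2 + n < w -> g (h.+2 + n) = Some false.
    elim: n => [|n IHn] lt_w.
      by have := row h.+1; rewrite Hn -[h.+3]addn0 => /(_ lt_w)/eqP; rewrite addn0.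
    have := row (h.+2 + n); rewrite -addnS => /(_ lt_w).
    by rewrite IHn ?(ltn_trans _ lt_w) ?ltn_add2l // => /eqP.
  rewrite /dir /=; case: (ltngtP h.+1 p) => [lt_hp|lt_ph|<-] //; last exact: Hr.
  by rewrite -(subnKC lt_hp) Hl // subnKC.
have Hl q : h <= q -> q < w -> g q = Some false.
  move=> le_q lt_q; have := step q lt_q.
  by rewrite /= /dir; case: (ltngtP h q) le_q => // _ _ /eqP.
have Hr q : q < h -> g q != Some false.
  move=> lt_q; have := step q (ltn_trans lt_q (ltnW lt_h)).
  by rewrite /= /dir; case: (ltngtP h q) lt_q.
have Hrow q : q.+1 < w -> dir_row (g q) (g q.+1) by exact: row.
case: h h0 lt_h Hl Hr {step} => // h _ lt_h Hl Hr.
have Hn : g h = None.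
  have := Hrow h (ltnW lt_h); rewrite (Hl h.+1) // ?(ltnW lt_h) // /dir_row.
  by have := Hr h (ltnSn h); case: (g h) => [[]|].
have Ht n q : q + n.+1 = h -> g q = Some true.
  elim: n q => [|n IHn] q Eq.
    have lt_q : q.+1 < w by lia.
    have := Hrow q lt_q; rewrite -[q.+1]addn1 Eq Hn /dir_row.
    by case: eqP.
  have lt_q : q.+1 < w by lia.
  have := Hrow q lt_q; rewrite (IHn q.+1) ?addSnnS // /dir_row.
  by case: eqP.
rewrite /dir /=; case: (ltngtP h p) => [lt_hp|lt_ph|<-] //; first exact: Hl.
by apply: (Ht (h - p.+1)); lia.
Qed.

Section Tableau.
Variables (M : machine) (x : seq bool) (T Q : nat).
Hypotheses (T0 : 0 < T) (QT : Q <= T).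
(** Heads start at position [T] and make at most [T] moves, so they stay within the positions 0,
    ..., [2 * T]. *)
Let W := (2 * T).+1.
Let S : finType := option (bool + work M)%type.
Let tapes := 'I_(extra_tapes M).+1.

(* State, scanned symbols, symbol and head direction on every tape, and a
   guessed bit of the second input. *)
Definition tile : finType :=
  ((state M * {ffun tapes -> S}) * {ffun tapes -> S * option bool} * option bool)%type.
Implicit Types a b : tile.

Definition tsta a : state M := a.1.1.1.
Definition trd a : {ffun tapes -> S} := a.1.1.2.
Definition tsy a (i : tapes) : S := (a.1.2 i).1.
Definition tdir a (i : tapes) : option bool := (a.1.2 i).2.
Definition tbit a : option bool := a.2.

(** A halted machine idles by rewriting what it scans, so all rows obey the same rule. *)
Definition trans (q : state M) (h : {ffun tapes -> S}) :
    state M * {ffun tapes -> tsym (work M) * move} :=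
  if halting q then (q, [ffun i => (h i : tsym _, MoveStay)]) else delta q h.

Lemma step_trans (c : config M) :
  step c = let: (q, w) := trans c.1 [ffun i => thead (c.2 i)] in
           (q, [ffun i => act (w i) (c.2 i)]).
Proof.
case: c => q ts; rewrite /trans /=; case: ifP => // _.
by congr pair; apply/ffunP => i; rewrite !ffunE act_stay.
Qed.

(** The scanned symbols are guessed for the whole row; only the cell under a head can confirm the
    guess for that tape. *)
Definition legal a : bool :=
  [forall i, (tdir a i == None) ==> (tsy a i == trd a i)].
Definition row_ok a b : bool :=
  [&& a.1.1 == b.1.1, legal a, legal b & [forall i, dir_row (tdir a i) (tdir b i)]].
Definition step_ok a b : bool :=
  let: (q, w) := trans (tsta a) (trd a) in
  (tsta b == q) &&
  [forall i, (tsy b i == if tdir a i == None then (w i).1 : S else tsy a i) &&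
             dir_step (w i).2 (tdir a i) (tdir b i)].
(** From position [T] on, no guessed bit follows a blank: the guessed bits form one string. *)
Definition bits_ok (p : nat) a b : bool :=
  (T <= p) && (tbit a == None) ==> (tbit b == None).

(** Written with comparisons and a lookup in [x], so that for a fixed symbol it is computed by an
    expression. *)
Definition input_sym (s : S) (p : nat) : bool :=
  match s with
  | None => (p < T) || (T + size x <= p)
  | Some (inl b) => [&& T <= p, p < T + size x & nth false x (p - T) == b]
  | Some (inr _) => false
  end.
(** The last clause confines the guessed bits to [Q] positions, which bounds the second input. The
    conjunction over an explicit list of tapes can be unrolled in an expression. *)
Definition start_ok (p : nat) a : bool :=
  [&& tsta a == start M,
      all (fun i => dir_is (tdir a i) T p &&
        (if i == 0 :> nat then input_sym (tsy a i) p
         else if i == 1 :> nat then tsy a i == omap inl (tbit a)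
         else tsy a i == None)) (enum tapes)
    & (tbit a == None) || ((T <= p) && (p < T + Q))].

(** Conditions on one cell are stated for neighbouring pairs too, since binary constraints join two
    distinct nodes. *)
Definition tableau (s : nat -> nat -> tile) : Prop :=
  [/\ forall t p, t <= T -> p.+1 < W -> row_ok (s t p) (s t p.+1),
      forall t p, t < T -> p < W -> step_ok (s t p) (s t.+1 p),
      forall p, p.+1 < W ->
        [&& bits_ok p (s 0 p) (s 0 p.+1), start_ok p (s 0 p) & start_ok p.+1 (s 0 p.+1)]
    & forall p, p.+1 < W -> accepting (tsta (s T p))].

(** * The tableau of a run *)

Section Run.
Variable y : seq bool.
Let c t := run M t [:: x; y].
Let heads t : {ffun tapes -> S} := [ffun i => thead ((c t).2 i)].

Fixpoint hpos (t : nat) (i : tapes) : nat :=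
  if t is t'.+1 then head_move ((trans (c t').1 (heads t')).2 i).2 (hpos t' i) else T.

Lemma hpos_bound t i : t <= T -> T - t <= hpos t i <= T + t.
Proof.
elim: t => [|t IHt] le_t; first by rewrite subn0 addn0 leqnn.
have /andP[] := IHt (ltnW le_t).
by rewrite /=; case: (_ .2) => /=; lia.
Qed.

Lemma run_step t : (c t.+1).1 = (trans (c t).1 (heads t)).1 /\
  forall i, (c t.+1).2 i = act ((trans (c t).1 (heads t)).2 i) ((c t).2 i).
Proof.
rewrite /c /run iterS step_trans -/(run M t [:: x; y]) -/(c t) -/(heads t).
by case: trans => q w; split=> // i; rewrite ffunE.
Qed.

Definition ybit (p : nat) : option bool := if p < T then None else onth y (p - T).

Lemma cell_load (z : seq bool) p :
  cell (load (work M) z) T p = if p < T then None else omap inl (onth z (p - T)).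
Proof.
rewrite /cell /=; case: ifP => // _; first by rewrite nth_nil.
case: z => [|b z] /=; first by case: (p - T) => //= k; rewrite nth_nil.
case: (p - T) => //= k; elim: z k => [|d z IHz] [|k] //=; exact: IHz.
Qed.

Lemma input_symE (s : S) p : input_sym s p =
  (s == if p < T then None else omap inl (onth x (p - T))).
Proof.
rewrite /input_sym; case: (ltnP p T) => [lt_p|le_p].
  by case: s => [[]|]; rewrite ?lt_p //= leqNgt lt_p.
have Es : (p < T + size x) = (p - T < size x) by lia.
have El : (T + size x <= p) = (size x <= p - T) by lia.
rewrite Es El /= ?le_p /=; move: (p - T) => k {Es El le_p}.
case: s => [[d|w]|] /=.
- elim: x k => [|b z IHz] [|k] //=; last by rewrite -IHz.
  by rewrite eq_sym.
- by elim: x k => [|b z IHz] [|k] //=.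
by elim: x k => [|b z IHz] [|k] //=; rewrite -IHz.
Qed.

Definition run_tile (t p : nat) : tile :=
  (((c t).1, heads t), [ffun i => (cell ((c t).2 i) (hpos t i) p : S, dir (hpos t i) p)],
   ybit p).

Lemma cell_step t i p : t < T ->
  cell ((c t.+1).2 i) (hpos t.+1 i) p =
  if p == hpos t i then ((trans (c t).1 (heads t)).2 i).1
  else cell ((c t).2 i) (hpos t i) p.
Proof.
move=> lt_t; have h0 : 0 < hpos t i by have := hpos_bound i (ltnW lt_t); lia.
have [_ ->] := run_step t; rewrite /=; move: (trans _ _).2 => w.
by case: (w i) => s m; exact: cell_act.
Qed.

Lemma hpos_pos t i : t < T -> 0 < hpos t i.
Proof. by move=> lt_t; have := hpos_bound i (ltnW lt_t); lia. Qed.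

Lemma run_tableau : size y <= Q -> accepting (c T).1 -> tableau run_tile.
Proof.
move=> le_y acc; split=> [t p le_t lt_p|t p lt_t lt_p|p lt_p|//].
- have lg q : legal (run_tile t q).
    apply/forallP => i; rewrite /tdir /tsy /trd /run_tile /= !ffunE /= /dir.
    by case: (hpos t i =P q) => [<-|_] //=; rewrite cell_head eqxx.
  rewrite /row_ok eqxx !lg /=; apply/forallP => i.
  by rewrite /tdir /run_tile /= !ffunE; exact: dir_rowP.
- have [E1 _] := run_step t; rewrite /step_ok /tsta /trd /=.
  have := E1; case Ew: (trans _ _) => [q w] /= ->; rewrite eqxx /=.
  apply/forallP => i; rewrite /tsy /tdir /run_tile /= !ffunE /=.
  apply/andP; split; last by rewrite Ew /=; apply: dir_stepP; exact: hpos_pos.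
  have := cell_step i p lt_t; rewrite /= Ew /= => ->; rewrite /dir [p == _]eq_sym.
  by case: (hpos t i =P p) => _ /=; rewrite eqxx.
have st q : start_ok q (run_tile 0 q).
  rewrite /start_ok /tsta /run_tile /= eqxx /=; apply/andP; split.
    apply/allP => i _; rewrite /tdir /tsy /= !ffunE /= dir_isE eqxx /=.
    rewrite /c /= ?ffunE; case: i => [[|[|k]] lt_k] /=.
    - by rewrite input_symE cell_load.
    - by rewrite cell_load /tbit /= /ybit; case: ifP.
    by rewrite nth_nil cell_load; case: ifP => //=; case: (q - T).
  rewrite /tbit /= /ybit; case: ltnP => //= le_q.
  have [lt_q|le_yq] := ltnP (q - T) (size y).
    by apply/orP; right; lia.
  apply/orP; left; apply/eqP; elim: (y) (q - T) le_yq => [|b z IHz] [|k] //=; exact: IHz.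
rewrite !st !andbT /bits_ok /tbit /= /ybit; apply/implyP => /andP[le_p].
rewrite !ltnNge le_p (leqW le_p) /= subSn //.
elim: (y) (p - T) => [|b z IHz] [|k] //=; last exact: IHz.
Qed.

(** Once the guessed bits are fixed, row 0 is forced, and each row forces the next: the states and
    symbols by [step_ok], the head positions by [dir_step_det]. *)
Lemma tableau_match s : tableau s ->
  (forall p, p < W -> tbit (s 0 p) = ybit p) ->
  forall t, t <= T -> forall p, p < W ->
  tsta (s t p) = (c t).1 /\
  forall i, tsy (s t p) i = cell ((c t).2 i) (hpos t i) p /\
            tdir (s t p) i = dir (hpos t i) p.
Proof.
case=> row stp start _ bits; elim=> [_ p lt_p|t IHt lt_t].
  have /and3P[/eqP Es /allP Ei _] : start_ok p (s 0 p).
    have lt1 : 1 < W by rewrite /W; lia.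
    case: p lt_p => [|p] lt_p; first by case/and3P: (start 0 lt1).
    by case/and3P: (start p lt_p).
  split=> // i; have := Ei i; rewrite mem_enum => /(_ isT)/andP[].
  rewrite dir_isE => /eqP Ed Hs; split=> //; rewrite /c /= ffunE.
  case: i Hs {Ed} => [[|[|k]] lt_k] /=.
  - by rewrite input_symE cell_load => /eqP.
  - by rewrite cell_load bits // /ybit => /eqP ->; case: ifP.
  by rewrite nth_nil cell_load => /eqP ->; case: ifP => //=; case: (p - T).
have {}IHt := IHt (ltnW lt_t).
have row0 p : p < W -> (s t p).1.1 = (s t 0).1.1.
  elim: p => // p IHp lt_p; rewrite -IHp ?(ltnW lt_p) //.
  by case/and4P: (row t p (ltnW lt_t) lt_p) => /eqP ->.
have lg p : p < W -> legal (s t p).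
  have lt1 : 1 < W by rewrite /W; lia.
  case: p => [|p] lt_p; last by case/and4P: (row t p (ltnW lt_t) lt_p).
  by case/and4P: (row t 0 (ltnW lt_t) lt1).
(* Each head lies inside the row, where [legal] makes the guess equal to the scanned symbol;
   equality along the row carries it to all cells. *)
have rdE p : p < W -> trd (s t p) = heads t.
  move=> lt_p; apply/ffunP => i; rewrite ffunE.
  have lt_h : hpos t i < W by have := hpos_bound i (ltnW lt_t); rewrite /W; lia.
  have := forallP (lg _ lt_h) i; have [_ /(_ i)[-> ->]] := IHt _ lt_h.
  by rewrite /dir eqxx /= cell_head => /eqP ->; rewrite /trd row0 // row0.
have next p : p < W -> tsta (s t.+1 p) = (trans (c t).1 (heads t)).1 /\ forall i,
   tsy (s t.+1 p) i = (if p == hpos t i then ((trans (c t).1 (heads t)).2 i).1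
                      else cell ((c t).2 i) (hpos t i) p) /\
   dir_step ((trans (c t).1 (heads t)).2 i).2 (dir (hpos t i) p) (tdir (s t.+1 p) i).
  move=> lt_p; have := stp t p lt_t lt_p; have [Es Ei] := IHt p lt_p.
  rewrite /step_ok Es rdE //; case: trans => q w /= /andP[/eqP -> /forallP Hi].
  split=> // i; have /andP[/eqP -> Hd] := Hi i; have [Esy Edir] := Ei i.
  rewrite -Edir; split=> //; rewrite Esy Edir /dir [p == _]eq_sym.
  by case: (hpos t i =P p).
move=> p lt_p; have [-> Hi] := next p lt_p; have [-> _] := run_step t.
split=> // i; split; first by rewrite cell_step //; case: (Hi i).
have := hpos_bound i (ltnW lt_t) => Hb.
apply: (@dir_step_det ((trans (c t).1 (heads t)).2 i).2 (hpos t i) W (fun p => tdir (s t.+1 p) i)) => //.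
- by lia.
- by rewrite /W; lia.
- by move=> q lt_q; have [_ /(_ i)[]] := next q lt_q.
by move=> q lt_q; case/and4P: (row t.+1 q lt_t lt_q) => _ _ _ /forallP.
Qed.
End Run.

Lemma tableauP : (exists s, tableau s) <->
  exists y, size y <= Q /\ accepting (run M T [:: x; y]).1.
Proof.
split=> [[s tab]|[y [le_y acc]]]; last by exists (run_tile y); exact: run_tableau.
have [_ _ start acc] := tab.
have start_all p : p < W -> start_ok p (s 0 p).
  have lt1 : 1 < W by rewrite /W; lia.
  case: p => [|p] lt_p; last by case/and3P: (start p lt_p).
  by case/and3P: (start 0 lt1).
pose isN j := tbit (s 0 (T + j)) == None.
(* The second input is read off row 0, from position [T] to the first blank; if there is none, [l]
   is [T.+1]. *)
pose l := find isN (iota 0 T.+1).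
have le_l : l <= T.+1 by rewrite /l (leq_trans (find_size _ _)) // size_iota.
pose y := [seq odflt false (tbit (s 0 (T + j))) | j <- iota 0 l].
have size_y : size y = l by rewrite size_map size_iota.
have before_l j : j < l -> tbit (s 0 (T + j)) != None.
  move=> lt_j; have := before_find 0 lt_j; rewrite nth_iota ?add0n ?(leq_trans lt_j) //.
  by rewrite /isN => ->.
have after_l j : l <= j -> j <= T -> tbit (s 0 (T + j)) = None.
  elim: j => [|j IHj]; rewrite leq_eqVlt => /orP[/eqP El|lt_l] le_j //.
  - have := @nth_find _ 0 isN (iota 0 T.+1); rewrite has_find size_iota -/l El /= => /(_ isT).
    by rewrite /isN => /eqP.
  - have := @nth_find _ 0 isN (iota 0 T.+1); rewrite has_find size_iota -/l El ltnS => /(_ le_j).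
    by rewrite nth_iota // add0n /isN => /eqP.
  have lt_w : (T + j).+1 < W by rewrite /W; lia.
  have /and3P[/implyP] := start _ lt_w.
  by rewrite leq_addr IHj // ?(ltnW le_j) // addnS => /(_ isT)/eqP.
have bits p : p < W -> tbit (s 0 p) = ybit y p.
  move=> lt_p; rewrite /ybit; case: ltnP => [lt_pT|le_p].
    have /and3P[_ _ /orP[/eqP //|/andP[le_p _]]] := start_all _ lt_p.
    by move: lt_pT; rewrite ltnNge le_p.
  have Ep : p = T + (p - T) by rewrite subnKC.
  have le_pT : p - T <= T by move: lt_p; rewrite /W; lia.
  rewrite {1}Ep; move: (p - T) le_pT => j le_j.
  case: (ltnP j l) => [lt_j|le_lj]; last first.
    by rewrite after_l // onth_default // size_y.
  have := onthTE y j; rewrite size_y lt_j; case E: (onth y j) => [b|] // _.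
  have := @onth_nth _ false _ _ _ E; rewrite (nth_map 0) ?size_iota // nth_iota // add0n => <-.
  by have := before_l j lt_j; case: tbit.
exists y; split.
  rewrite size_y; case El : l => [|j] //.
  have lt_j : j < l by rewrite El.
  have lt_w : T + j < W by move: le_l; rewrite /W El; lia.
  have /and3P[_ _ /orP[E|/andP[_]]] := start_all _ lt_w; last by rewrite ltn_add2l.
  by have := before_l j lt_j; rewrite E.
have [Es _] := tableau_match tab bits (leqnn T) (ltn0Sn (2 * T)).
by rewrite -Es; apply: acc; rewrite /W; lia.
Qed.
End Tableau.

(** * The reduction *)

(** Case analysis over a fixed finite table: whatever depends on the entry alone becomes a constant
    of the expression. This is how the transition function of the machine enters the reduction. *)
Lemma bool_expr_nth_const (X Y : Type) (vs : seq (X -> seq bool)) (y0 : Y) (s : seq Y)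
    (B : Y -> X -> bool) (f : X -> nat) :
  nat_expr vs f -> (forall y, bool_expr vs (B y)) -> bool_expr vs (fun x => B (nth y0 s (f x)) x).
Proof.
move=> Hf HB; elim: s f Hf => [|y s IHs] f Hf.
  by apply: bool_expr_ext (HB y0) => x; rewrite nth_nil.
have H0 : bool_expr vs (fun x => f x == 0) by exact: bool_expr_eq Hf (nat_expr_const _ _).
have H1 : nat_expr vs (fun x => f x - 1) by exact: nat_expr_sub Hf (nat_expr_const _ _).
apply: bool_expr_ext (bool_expr_if H0 (HB y) (IHs _ H1)) => x.
by case: (f x) => [|k] //=; rewrite subn1.
Qed.

Lemma flatten_map_flatten (A B C : Type) (h : B -> seq C) (g : A -> seq B) s :
  flatten [seq h b | b <- flatten [seq g a | a <- s]] =
  flatten [seq flatten [seq h b | b <- g a] | a <- s].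
Proof. by elim: s => //= a s IHs; rewrite map_cat flatten_cat IHs. Qed.

Lemma halting_run (M : machine) m n inputs : m <= n ->
  halting (run M m inputs).1 -> run M n inputs = run M m inputs.
Proof.
move=> le_mn halt; rewrite -(subnK le_mn) /run iterD -/(run M m inputs).
elim: (n - m) => //= k ->; move: halt; case: (run M m inputs) => q ts /= hq.
by rewrite hq.
Qed.

Section Reduction.
Variables (M : machine) (pt pc : {poly nat}).
Implicit Types (x : seq bool) (a b : tile M).

Definition cert_size x : nat := pc.[size x]%R.
(** The running time for a certificate of maximal length, enlarged so that [cert_size x <= time x]
    and [0 < time x], as the tableau requires. *)
Definition time x : nat := pt.[(size x + cert_size x)%N]%R + cert_size x + 1.
Definition width x : nat := (2 * time x).+1.

Definition tile0 : tile M :=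
  ((start M, [ffun=> None]), [ffun=> (None, None)], None).
Definition tile_of (d : nat) : tile M := nth tile0 (enum (tile M)) d.

(** Node [u] is the cell in row [u %/ width x] and column [u %% width x]. Its right neighbour is
    [u.+1] unless the column is the last one, and the cell of the next row is [u + width x]. *)
Definition tile_conflict x (u : nat) a (u' : nat) b : bool :=
  ((u' == u.+1) && ((u %% width x).+1 < width x) &&
    (~~ row_ok a b
     || ((u %/ width x == 0) &&
         ~~ (bits_ok (time x) (u %% width x) a b &&
             (start_ok x (time x) (cert_size x) (u %% width x) a &&
              start_ok x (time x) (cert_size x) (u %% width x).+1 b)))
     || ((u %/ width x == time x) && ~~ accepting (tsta a))))
  || ((u' == u + width x) && ~~ step_ok a b).

Definition nodes x : nat := (time x).+1 * width x.
Definition values : nat := #|tile M|.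
Definition node_conflict x (u d u' d' : nat) : bool :=
  tile_conflict x u (tile_of d) u' (tile_of d').

Lemma values_gt0 : 0 < values.
Proof. by apply/card_gt0P; exists tile0. Qed.

Lemma tile_of_index a : tile_of (index a (enum (tile M))) = a.
Proof. by rewrite /tile_of nth_index // mem_enum. Qed.

Lemma tableau_csp x : (exists s : nat -> nat -> tile M, tableau x (time x) (cert_size x) s) <->
  exists s, csp_solution (nodes x) values (node_conflict x) s.
Proof.
set T := time x; set W := width x.
have W0 : 0 < W by [].
have node_lt t p : t <= T -> p < W -> t * W + p < nodes x.
  move=> le_t lt_p; rewrite /nodes -/T -/W; apply: (@leq_trans (t.+1 * W)).
    by rewrite mulSn addnC ltn_add2r.
  by rewrite leq_mul2r ltnS le_t orbT.
split=> [[s [row stp st acc]]|[s [_ free]]].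
  exists (fun u => index (s (u %/ W) (u %% W)) (enum (tile M))).
  split=> [u _|u u' lt_u lt_u' _]; first by rewrite /values cardE index_mem mem_enum.
  rewrite /node_conflict !tile_of_index /tile_conflict -/W -/T.
  have le_t v : v < nodes x -> v %/ W <= T by rewrite /nodes -/T -/W => lt_v; rewrite -ltnS ltn_divLR.
  have Eu := divn_eq u W; have lt_p : u %% W < W by rewrite ltn_mod.
  apply/norP; split.
    apply/negP => /andP[/andP[/eqP Eu' lt_p1]].
    have [-> ->] : u' %/ W = u %/ W /\ u' %% W = (u %% W).+1.
      rewrite Eu'; move: Eu lt_p1; move: (u %/ W) (u %% W) => t p -> lt_p1.
      by rewrite -addnS divnMDl // modnMDl divn_small // modn_small // addn0.
    rewrite row ?le_t //=; case/orP => /andP[/eqP Et].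
      by rewrite Et; have /and3P[-> -> ->] := st _ lt_p1.
    by rewrite Et acc.
  apply/negP => /andP[/eqP Eu'].
  have [Ed Em] : u' %/ W = (u %/ W).+1 /\ u' %% W = u %% W.
    by rewrite Eu' divnDr ?dvdnn // divnn W0 addn1 modnDr.
  rewrite Ed Em stp //; have := le_t _ lt_u'; by rewrite Ed.
exists (fun t p => tile_of (s (t * W + p))).
have free1 t p : t <= T -> p.+1 < W -> ~~ tile_conflict x (t * W + p) (tile_of (s (t * W + p)))
    (t * W + p).+1 (tile_of (s (t * W + p).+1)).
  move=> le_t lt_p; apply: free; rewrite ?neq_ltn ?ltnSn //.
    exact: node_lt (ltnW lt_p).
  by rewrite -addnS; exact: node_lt.
have coord t p : p < W -> (t * W + p) %/ W = t /\ (t * W + p) %% W = p.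
  by move=> lt_p; rewrite divnMDl // modnMDl divn_small ?modn_small ?addn0.
split=> [t p le_t lt_p|t p lt_t lt_p|p lt_p|p lt_p].
- have := free1 t p le_t lt_p; have [E1 E2] := coord t p (ltnW lt_p).
  rewrite /tile_conflict -/W -/T E1 E2 eqxx lt_p -addnS /=.
  by rewrite !negb_or negbK => /andP[/andP[/andP[->]]].
- have lt_u : t * W + p < nodes x by exact: node_lt (ltnW lt_t) lt_p.
  have lt_u' : t.+1 * W + p < nodes x by exact: node_lt.
  have ne : t * W + p != t.+1 * W + p by rewrite eqn_add2r mulSn; lia.
  have := free _ _ lt_u lt_u' ne; rewrite /node_conflict /tile_conflict -/W.
  have -> : t.+1 * W + p == t * W + p + W by rewrite mulSn; lia.
  by rewrite negb_or /= negbK => /andP[].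
- have := free1 0 p (leq0n T) lt_p; have [E1 E2] := coord 0 p (ltnW lt_p).
  rewrite /tile_conflict -/W -/T E1 E2 eqxx lt_p -addnS /=.
  by rewrite !negb_or !negbK => /andP[/andP[/andP[_]]].
have := free1 T p (leqnn T) lt_p; have [E1 E2] := coord T p (ltnW lt_p).
rewrite /tile_conflict -/W -/T E1 E2 !eqxx lt_p -addnS /=.
by rewrite !negb_or !negbK => /andP[/andP[_ ->]].
Qed.

Definition reduction x : seq bool :=
  encode_instance (triple_instance (nodes x * values)
    (csp_conflict values (node_conflict x))).

Lemma reductionP x : FSTAC_on_fan_stars (reduction x) <->
  exists y, size y <= cert_size x /\ accepting (run M (time x) [:: x; y]).1.
Proof.
have k0 : 0 < nodes x * values by rewrite muln_gt0 values_gt0.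
have T0 : 0 < time x by rewrite /time addn1.
have QT : cert_size x <= time x by rewrite /time; lia.
rewrite -(@tableauP M x _ _ T0 QT) tableau_csp /reduction triple_instanceP //.
split=> [[X HX]|[s Hs]]; last exact: (csp_selection values_gt0 Hs).
exact: (selection_csp values_gt0 HX).
Qed.

(** * The reduction as an expression *)

Section Definability.
Variables (X : Type) (vs : seq (X -> seq bool)) (x : X -> seq bool).
Hypothesis Hx : str_expr vs x.

Lemma nat_expr_cert : nat_expr vs (fun z => cert_size (x z)).
Proof. by rewrite /cert_size; closure. Qed.

Lemma nat_expr_time : nat_expr vs (fun z => time (x z)).
Proof. by have Hc := nat_expr_cert; rewrite /time; closure. Qed.

Lemma bool_expr_start (p : X -> nat) a : nat_expr vs p ->
  bool_expr vs (fun z => start_ok (x z) (time (x z)) (cert_size (x z)) (p z) a).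
Proof.
move=> Hp; have Hc := nat_expr_cert; have Ht := nat_expr_time; rewrite /start_ok.
apply: bool_expr_and; first exact: bool_expr_const.
apply: bool_expr_and; last by closure.
apply: bool_expr_all_const => i; apply: bool_expr_and.
  by case: (tdir a i) => [[]|] /=; closure.
closure; rewrite /input_sym.
by case: (tsy a i) => [[c|w]|] /=; closure.
Qed.

Lemma bool_expr_tile_conflict (u u' : X -> nat) a b : nat_expr vs u -> nat_expr vs u' ->
  bool_expr vs (fun z => tile_conflict (x z) (u z) a (u' z) b).
Proof.
move=> Hu Hu'; have Ht := nat_expr_time.
have Hw : nat_expr vs (fun z => width (x z)) by rewrite /width; closure.
have Hp : nat_expr vs (fun z => u z %% width (x z)) by closure.
have Hs := bool_expr_start a Hp; have Hs' := bool_expr_start b (nat_expr_S Hp).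
by rewrite /tile_conflict /bits_ok; closure.
Qed.

Lemma bool_expr_node_conflict (u d u' d' : X -> nat) :
  nat_expr vs u -> nat_expr vs d -> nat_expr vs u' -> nat_expr vs d' ->
  bool_expr vs (fun z => node_conflict (x z) (u z) (d z) (u' z) (d' z)).
Proof.
move=> Hu Hd Hu' Hd'; rewrite /node_conflict /tile_of.
apply: (@bool_expr_nth_const _ _ _ tile0 (enum (tile M)) (fun a z =>
  tile_conflict (x z) (u z) a (u' z) (nth tile0 (enum (tile M)) (d' z)))) => // a.
apply: (@bool_expr_nth_const _ _ _ tile0 (enum (tile M)) (fun b z =>
  tile_conflict (x z) (u z) a (u' z) b)) => // b.
exact: bool_expr_tile_conflict.
Qed.

Lemma bool_expr_csp_conflict (i j : X -> nat) : nat_expr vs i -> nat_expr vs j ->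
  bool_expr vs (fun z => csp_conflict values (node_conflict (x z)) (i z) (j z)).
Proof.
move=> Hi Hj; rewrite /csp_conflict /labelled.
have Hn (f : X -> nat) : nat_expr vs f -> nat_expr vs (fun z => node values (f z)).
  by move=> Hf; rewrite /node; closure.
have Hv (f : X -> nat) : nat_expr vs f -> nat_expr vs (fun z => value values (f z)).
  by move=> Hf; rewrite /value; closure.
have Hni := Hn _ Hi; have Hnj := Hn _ Hj; have Hvi := Hv _ Hi; have Hvj := Hv _ Hj.
have Hc := bool_expr_node_conflict Hni Hvi Hnj Hvj.
by closure.
Qed.
End Definability.

Lemma str_expr_reduction : str_expr [:: id] reduction.
Proof.
have Hx : str_expr [:: id] (fun x : seq bool => x) by exists (Var 0).
have Ht := nat_expr_time Hx.
have HK : nat_expr [:: id] (fun x => nodes x * values).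
  by rewrite /nodes /width; closure.
have Hx2 := str_expr_wk (str_expr_wk Hx).
have HC := bool_expr_csp_conflict Hx2 (nat_expr_wk (nat_expr_idx [:: id])) (nat_expr_idx (ext [:: id])).
pose en n := nseq n true ++ [:: false].
(* The same string spelled out with plain numbers; it agrees with [reduction] because every argument
   of [inord] is in range. *)
pose f x := en (3 * (nodes x * values)).+1 ++
  ((flatten [seq true :: (en 0 ++ en i.+1) | i <- rev (iota 0 (3 * (nodes x * values)))] ++
    flatten [seq (if i %% 3 != 0 then true :: (en i ++ en i.+1) else [::])
      | i <- rev (iota 0 (3 * (nodes x * values)))]) ++ [:: false]) ++
  (flatten [seq flatten [seq
       (if (i != j) && csp_conflict values (node_conflict x) i j
        then true :: ((en 0 ++ en i.+1) ++ (en 0 ++ en j.+1)) else [::])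
     | j <- rev (iota 0 (3 * (nodes x * values)))]
   | i <- rev (iota 0 (3 * (nodes x * values)))] ++ [:: false]).
have Ef : f =1 reduction.
  move=> x; rewrite /f /reduction; set K := nodes x * values.
  set C := csp_conflict _ _; rewrite /encode_instance !encode_seqE encode_natE.
  congr (_ ++ (( _ ++ _) ++ (_ ++ _))); rewrite /= /triple_edges /triple_conflicts.
    rewrite map_cat flatten_cat flatten_map_flatten; congr (_ ++ _).
      rewrite -map_comp; congr flatten; apply/eq_in_map => i; rewrite mem_rev mem_iota => /andP[_ lt_i].
      by rewrite /= /encode_edge /encode_pair !encode_natE /= inordK.
    congr flatten; apply/eq_in_map => i; rewrite mem_rev mem_iota => /andP[_ lt_i].
    case: ifP => //= _; rewrite cats0.
    by rewrite /encode_edge /encode_pair !encode_natE /= !inordK // ltnS ltnW.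
  rewrite flatten_map_flatten; congr flatten; apply/eq_in_map => i.
  rewrite mem_rev mem_iota flatten_map_flatten => /andP[_ lt_i].
  congr flatten; apply/eq_in_map => j; rewrite mem_rev mem_iota => /andP[_ lt_j].
  case: ifP => //= _; rewrite cats0.
  by rewrite /encode_pair /encode_edge /encode_pair !encode_natE /= !inordK.
apply: (str_expr_ext Ef); rewrite /f /en.
by closure.
Qed.
End Reduction.

Theorem FSTAC_NP_hard : NP_hard FSTAC_on_fan_stars.
Proof.
move=> L [V [pc [[M [pt HM]] HL]]].
exists (reduction M pt pc); split.
  have [e He] := str_expr_reduction M pt pc.
  have [M' [p' H]] := polytime_fun_eval e.
  by exists M', p' => x; have [h1 h2] := H x; split=> //; rewrite h2 -He.
move=> x.
(* The bound [time] does not depend on the certificate; running past the halting time changes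
   nothing. *)
have HR y : size y <= pc.[size x]%R ->
    run M (time pt pc x) [:: x; y] = run M pt.[(size x + size y)%N]%R [:: x; y].
  move=> le_y; apply: halting_run; last by case: (HM x y).
  rewrite /time -addnA (leq_trans _ (leq_addr _ _)) //.
  by apply: horner_nat_mono; rewrite leq_add2l.
rewrite HL reductionP; split=> -[y [le_y Hy]]; exists y; split=> //.
  by rewrite HR //; have [_ ->] := HM x y.
by have [_ <-] := HM x y; rewrite -HR.
Qed.

Theorem theorem3 : NP_complete FSTAC_on_fan_stars.
Proof. by split; [exact: FSTAC_in_NP | exact: FSTAC_NP_hard]. Qed.
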